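(* Let $k$ be a field, let $Q=k[x_1,\ldots,x_n]$, and let $I\subsetneq Q$ be a squarefree monomial ideal such that $(\partial_{x_i}(I)\,\partial_{x_j}(I))^{\mathrm{sqf}}\subseteq I$ for all $i\ne j$ (in particular, this holds if $I$ is squarefree strongly Golod). Then $I$ is Golod.
   Context: $Q$ has the standard grading. $\partial_{x_i}(I)$ denotes the ideal generated by the partial derivatives with respect to $x_i$ of the elements of $I$. For a monomial ideal $L$, $L^{\mathrm{sqf}}$ denotes the ideal generated by the squarefree monomials belonging to $L$. A squarefree monomial ideal $I$ is squarefree strongly Golod if $(\partial_{x_i}(I)\,\partial_{x_j}(I))^{\mathrm{sqf}}\subseteq I$ for all $i,j$ (including $i=j$). Golod: let $R=Q/I$ with $I$ a proper homogeneous ideal; let $\mathfrak m$ be the homogeneous maximal ideal of $R$, $\operatorname{edim}(R)=\dim_k(\mathfrak m/\mathfrak m^2)$, and $K^R$ the Koszul complex on a minimal generating set of $\mathfrak m$. $R$ is Golod if $$\sum_{i\ge 0}\dim_k\operatorname{Tor}_i^R(k,k)\,t^i=\frac{(1+t)^{\operatorname{edim}(R)}}{1-\sum_{j\ge1}\dim_k H_j(K^R)\,t^{j+1}}.$$ The ideal $I$ is called Golod if $R=Q/I$ is Golod. *)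

(* Defs.v *)
From HB Require Import structures.
From mathcomp Require Import all_boot all_order all_algebra.
From mathcomp Require Import generic_quotient ring_quotient.
From mathcomp.multinomials Require Import mpoly.

Set Implicit Arguments.
Unset Strict Implicit.
Unset Printing Implicit Defensive.

Import GRing.Theory.
Local Open Scope ring_scope.
Local Open Scope quotient_scope.

Section Ideals.
Variable R : comNzRingType.

Definition ideal_gen (S : R -> Prop) (f : R) : Prop :=
  exists s : seq (R * R),
    (forall p, p \in s -> S p.2) /\ f = \sum_(p <- s) p.1 * p.2.

Definition ideal_prod (A B : R -> Prop) : R -> Prop :=
  ideal_gen (fun h => exists f g, [/\ A f, B g & h = f * g]).

End Ideals.

Section MonomialIdeals.
Variables (k : fieldType) (n : nat).
Local Notation Q := {mpoly k[n]}.

Definition sqfree_mnm (m : 'X_{1..n}) : Prop := forall i : 'I_n, (m i <= 1)%N.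

Definition sqfree_monomial_ideal (I : Q -> Prop) : Prop :=
  exists S : 'X_{1..n} -> Prop,
    (forall m, S m -> sqfree_mnm m) /\
    (forall f, I f <-> ideal_gen (fun g => exists2 m, S m & g = 'X_[m]) f).

Definition deriv_ideal (i : 'I_n) (I : Q -> Prop) : Q -> Prop :=
  ideal_gen (fun g => exists2 f, I f & g = mderiv i f).

Definition sqf_part (L : Q -> Prop) : Q -> Prop :=
  ideal_gen (fun g => exists m, [/\ sqfree_mnm m, g = 'X_[m] & L g]).

Definition deriv_sqf_sub (I : Q -> Prop) (i j : 'I_n) : Prop :=
  forall f, sqf_part (ideal_prod (deriv_ideal i I) (deriv_ideal j I)) f -> I f.

Definition sqfree_strongly_golod (I : Q -> Prop) : Prop :=
  sqfree_monomial_ideal I /\ forall i j, deriv_sqf_sub I i j.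

End MonomialIdeals.

(* [d] is the [k]-dimension of [U / W], where [W] is contained in [U] and both
   are [k]-subspaces of the [R]-module [V] through the ring morphism [iota]:
   there is a family of [d] vectors of [U] whose classes form a basis. *)
Definition quot_dim (k : fieldType) (R : comNzRingType) (iota : k -> R)
    (V : lmodType R) (U W : V -> Prop) (d : nat) : Prop :=
  exists v : 'I_d -> V,
    [/\ forall i, U (v i),
        forall c : 'I_d -> k,
          W (\sum_i iota (c i) *: v i) -> forall i, c i = 0
      & forall u, U u ->
          exists c : 'I_d -> k, W (u - \sum_i iota (c i) *: v i)].

Section Tor.
Variables (k : fieldType) (R : comNzRingType) (eps : R -> k).

(* A resolution  ... -> R^(rk 2) -> R^(rk 1) -> R^(rk 0) -> k -> 0  of [k],
   seen as an [R]-module through the surjective ring morphism [eps], by free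
   modules of finite rank (one exists as soon as [R] is Noetherian). Matrices
   act on row vectors from the right; an [R]-linear map R^b -> k is
   [u |-> eps(u) *m a], where the column [a] lists the images of the basis. *)
Record free_resolution := FreeResolution {
  rk : nat -> nat;
  diff : forall i, 'M[R]_(rk i.+1, rk i);
  aug : 'cV[k]_(rk 0);
  aug_surj : forall c : k,
    exists u : 'rV[R]_(rk 0), map_mx eps u *m aug = c%:M;
  exact_aug : forall u : 'rV[R]_(rk 0),
    map_mx eps u *m aug = 0 <-> exists v, u = v *m diff 0;
  exact_diff : forall i (u : 'rV[R]_(rk i.+1)),
    u *m diff i = 0 <-> exists v, u = v *m diff i.+1
}.

(* The dimension of Tor_i^R(k, k), the i-th homology of [F] tensored with [k]:
   the complex of the k^(rk i) whose differentials are the images of the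
   [diff i] under [eps]. *)
Definition tor_dim (F : free_resolution) (i : nat) : nat :=
  match i with
  | 0 => rk F 0 - \rank (map_mx eps (diff F 0))
  | j.+1 => \rank (kermx (map_mx eps (diff F j)))
            - \rank (map_mx eps (diff F j.+1))
  end.

End Tor.

Section Koszul.
Variables (R : comNzRingType) (r : nat) (y : 'I_r -> R).

(* The exterior algebra of R^r: [f] stands for the sum over [S] of
   [f S] e_S, where e_S is the wedge of the e_s, s in [S], in increasing
   order. *)
Definition koszul := {ffun {set 'I_r} -> R^o}.

(* d(e_S) = \sum_(s in S) (-1)^#{t in S | t < s} y_s e_(S \ s), read off on
   the coefficient of e_T, with S = s |: T. *)
Definition koszul_diff (f : koszul) : koszul :=
  [ffun T : {set 'I_r} => \sum_(s | s \notin T)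
     (-1) ^+ #|[set t in T | (t < s)%N]| * y s * f (s |: T)].

Definition koszul_deg (j : nat) (f : koszul) : Prop :=
  forall S : {set 'I_r}, #|S| != j -> f S = 0.

Definition koszul_cycle (j : nat) (f : koszul) : Prop :=
  koszul_deg j f /\ koszul_diff f = 0.

Definition koszul_bound (j : nat) (f : koszul) : Prop :=
  exists g, koszul_deg j.+1 g /\ f = koszul_diff g.

End Koszul.

Definition cauchy_prod (a b : nat -> int) (N : nat) : int :=
  \sum_(i < N.+1) a i * b (N - i)%N.

Section Golod.
Variables (k : fieldType) (n : nat) (I : idealr {mpoly k[n]}).
Local Notation Q := {mpoly k[n]}.
Local Notation R := {ideal_quot I}.

Definition quot_const (c : k) : R := \pi_R (c%:MP : Q).

(* The residue map R -> R / m = k. It does not depend on the representative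
   when [I] is homogeneous, since the elements of a proper homogeneous ideal
   have no constant term. *)
Definition residue (x : R) : k := (repr x : Q)@_0%MM.

Definition max_ideal : R -> Prop :=
  ideal_gen (fun x : R => exists i : 'I_n, x = \pi_R ('X_i : Q)).

Definition quot_homog (x : R) : Prop :=
  exists d, exists2 p : Q, p \is d.-homog & x = \pi_R p.

(* Homogeneity matters: there are inclusion-minimal generating sets of m with
   more than edim(R) elements, such as {x - x^2, x^2} in k[x]. *)
Definition min_gens (r : nat) (y : 'I_r -> R) : Prop :=
  [/\ forall s, quot_homog (y s),
      forall x, max_ideal x <-> ideal_gen (fun z => exists s, z = y s) x
    & forall t, ~ forall x, max_ideal x ->
        ideal_gen (fun z => exists2 s, s != t & z = y s) x].

Definition is_edim (e : nat) : Prop :=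
  quot_dim quot_const (V := R^o) max_ideal (ideal_prod max_ideal max_ideal) e.

Definition is_koszul_betti (r : nat) (y : 'I_r -> R) (j d : nat) : Prop :=
  quot_dim quot_const (koszul_cycle y j) (koszul_bound y j) d.

(* The coefficients of 1 - \sum_(j >= 1) h_j t^(j+1). *)
Definition golod_denom (h : nat -> nat) (m : nat) : int :=
  match m with
  | 0 => 1
  | 1 => 0
  | j.+1 => - (h j)%:Z
  end.

(* The embedding dimension, the minimal generators, the dimensions of the
   Koszul homology and the free resolution all exist, and the series do not
   depend on the choices. The equality of power series is multiplied through
   by the denominator, which is a unit of Z[[t]]. *)
Definition golod : Prop :=
  exists (e r : nat) (y : 'I_r -> R) (h : nat -> nat)
         (F : free_resolution residue),
    [/\ is_edim e, min_gens y, forall j, is_koszul_betti y j (h j)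
      & forall N, cauchy_prod (fun i => (tor_dim F i)%:Z) (golod_denom h) N
                  = 'C(e, N)%:Z].

End Golod.

(* Main.v *)
Require Import Defs.
From HB Require Import structures.
From mathcomp Require Import all_boot all_order all_algebra.
From mathcomp Require Import generic_quotient ring_quotient.
From mathcomp.multinomials Require Import mpoly.
From mathcomp Require Import ring zify.

(* Let [U] be a squarefree multidegree and [i] a variable in [U].
   Contracting by [e_i] shows that every class of multidegree [U] in the Koszul
   homology of R = Q/I has a cycle with coefficients in the ideal of the
   derivatives of I with respect to x_i, in every characteristic. If the supports
   [U] and [V] are disjoint, the product of two such cycles for i in [U] and j in
   [V] (so that i <> j) has squarefree coefficients, hence vanishes by the
   hypothesis. In a non-squarefree multidegree, say divisible by x_i^2, the Koszul
   complex of R is contractible, because dividing by x_i is compatible with I. So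
   a trivial Massey operation exists: it is zero on two or more classes in
   squarefree multidegrees, and it is given by the contraction in the other ones.
   It yields Golod's resolution of k, the Koszul complex tensored with the tensor
   coalgebra on the shifted Koszul homology; this resolution is minimal and its
   ranks have the required generating series. *)

Set Implicit Arguments.
Unset Strict Implicit.
Unset Printing Implicit Defensive.

Import GRing.Theory.
Local Open Scope ring_scope.

(** * The Koszul complex *)

(** The multidegree separates two mechanisms. If [e_S] and the supports of the letters are pairwise
    disjoint, the multidegree is squarefree and the products of representatives vanish by the
    hypothesis. If anything overlaps, some variable has exponent at least 2, and contraction by it
    solves the Massey equations without any assumption on I. The usual argument with derivatives
    rests on the Euler formula and divides by degrees. Here each squarefree multidegree is treated
    on its own: a variable of its support has exponent 1 there, so contraction by a single e_i is a
    homotopy for the identity with coefficient 1. Exactness comes from filtering by the last letter,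
    the connecting map sending a letter to its Koszul cycle. Variables of Q lying in I vanish in R,
    so the argument is carried out for an abstract Stanley-Reisner ring on the remaining
    variables. *)

Section KoszulSign.
Variables (R : comNzRingType) (r : nat).
Implicit Types (S T : {set 'I_r}) (s t i : 'I_r).

Definition ksign s T : R := (-1) ^+ #|[set t in T | (t < s)%N]|.

Lemma ksignK s T : ksign s T * ksign s T = 1.
Proof. by rewrite -expr2 sqrr_sign. Qed.

Lemma ksignU1 s t T : t \notin T ->
  ksign s (t |: T) = (-1) ^+ (t < s)%N * ksign s T.
Proof.
move=> tT; rewrite /ksign -exprD; congr (_ ^+ _).
have [lts|nlts] := boolP (t < s)%N; last first.
  apply: eq_card => u; rewrite !inE; case: eqP => [->|] //=.
  by rewrite (negbTE nlts) !andbF.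
rewrite (cardsD1 t) !inE eqxx lts /=; congr (_ + _)%N.
apply: eq_card => u; rewrite !inE; case: eqP => [->|] //=.
by rewrite (negbTE tT).
Qed.

Lemma ksignU11 s T : ksign s (s |: T) = ksign s T.
Proof.
have [sT|/ksignU1->] := boolP (s \in T); last by rewrite ltnn mul1r.
by rewrite (setUidPr _) // sub1set.
Qed.

Lemma ksignD11 s T : ksign s (T :\ s) = ksign s T.
Proof.
have [sT|sT] := boolP (s \in T); first by rewrite -[in RHS](setD1K sT) ksignU11.
by rewrite (setDidPl _) // disjoint_sym disjoints1.
Qed.
End KoszulSign.

Section KoszulGeneral.
Variables (R : comNzRingType) (r : nat) (y : 'I_r -> R).
Local Notation K := (koszul R r).
Local Notation d := (koszul_diff y).
Implicit Types (S T : {set 'I_r}) (s t i : 'I_r) (f g : K).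

Lemma kdE f T : d f T = \sum_(s | s \notin T) ksign R s T * y s * f (s |: T).
Proof. by rewrite ffunE. Qed.

Lemma koszulB f g T : (f - g) T = f T - g T.
Proof. by rewrite 2!ffunE. Qed.

Lemma koszulD f g T : (f + g) T = f T + g T.
Proof. by rewrite ffunE. Qed.

Lemma kdB f g : d (f - g) = d f - d g.
Proof.
apply/ffunP=> T; rewrite !ffunE -sumrB; apply: eq_bigr => s _.
by rewrite !ffunE mulrBr.
Qed.

Lemma kd0 : d 0 = 0.
Proof. by have := kdB 0 0; rewrite !subrr. Qed.

Lemma kdN f : d (- f) = - d f.
Proof. by rewrite -sub0r kdB kd0 sub0r. Qed.

Lemma kdD f g : d (f + g) = d f + d g.
Proof. by rewrite -{1}[g]opprK kdB kdN opprK. Qed.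

Lemma kdZ (c : R) f : d (c *: f) = c *: d f.
Proof.
apply/ffunP=> T; rewrite !ffunE [RHS]mulr_sumr; apply: eq_bigr => s _.
by rewrite !ffunE /GRing.scale /= mulrCA.
Qed.

Lemma kd_linear : linear d.
Proof. by move=> a u v; rewrite kdD kdZ. Qed.
HB.instance Definition _ := GRing.isLinear.Build R K K *:%R d kd_linear.

Lemma kd_sum (J : Type) (l : seq J) (P : pred J) (F : J -> K) :
  d (\sum_(j <- l | P j) F j) = \sum_(j <- l | P j) d (F j).
Proof. exact: (big_morph _ kdD kd0). Qed.

Lemma kd_deg j f : koszul_deg j.+1 f -> koszul_deg j (d f).
Proof.
move=> df S Sj; rewrite kdE big1 // => s sS; rewrite df ?mulr0 //.
by rewrite cardsU1 sS add1n eqSS.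
Qed.

Lemma kdd f : d (d f) = 0.
Proof.
apply/ffunP=> T; rewrite kdE [RHS]ffunE.
pose A s t := ksign R s T * y s * (ksign R t (s |: T) * y t * f (t |: (s |: T))).
pose P s t := [&& s \notin T, t \notin T & s != t].
have AN s t : P s t -> A s t = - A t s.
  case/and3P=> sT tT st; rewrite /A !ksignU1 // (setUCA [set t]).
  have -> : (-1) ^+ (t < s)%N = - (-1) ^+ (s < t)%N :> R.
    case: (ltngtP s t) => [_|_|/ord_inj e]; rewrite ?expr1 ?expr0 ?opprK //.
    by rewrite e eqxx in st.
  ring.
transitivity (\sum_s \sum_(t | P s t) A s t).
  rewrite [RHS]big_mkcond [LHS]big_mkcond; apply: eq_bigr => s _ /=.
  have [sT|sT] := boolP (s \notin T); last first.
    by rewrite big_pred0 // => t; rewrite /P (negbTE sT).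
  rewrite kdE mulr_sumr; apply: eq_bigl => t.
  by rewrite /P sT !inE negb_or eq_sym andbC.
(* The sum is split into s < t and t < s because antisymmetry alone only shows that twice the sum
   vanishes, which says nothing in characteristic 2. *)
pose Q s t := P s t && (s < t)%N.
have -> : \sum_s \sum_(t | P s t) A s t =
    \sum_s \sum_(t | Q s t) A s t + \sum_s \sum_(t | Q t s) A s t.
  rewrite -big_split; apply: eq_bigr => s _ /=.
  rewrite (bigID (fun t => (s < t)%N)) /=; congr (_ + _).
  apply: eq_bigl => t; rewrite /Q /P [t == s]eq_sym.
  case: (s \notin T); case: (t \notin T) => //=.
  by case: (ltngtP s t) => // /ord_inj ->; rewrite eqxx.
rewrite [X in _ + X](exchange_big_dep predT) //= -big_split big1 // => s _ /=.
rewrite -big_split big1 // => t /andP[Pst _] /=.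
by rewrite (AN _ _ Pst) addNr.
Qed.

(* The operator f |-> e_i /\ h(f), with h applied to the coefficients. *)
Definition wedge (h : R -> R) i f : K :=
  [ffun T : {set 'I_r} => if i \in T then ksign R i T * h (f (T :\ i)) else 0].

(** The terms with s <> i cancel in pairs because e_i anticommutes past e_s and h commutes with y_s;
    only s = i survives. For h the identity this is a homotopy for multiplication by y_i, and for h
    a division by y_i it becomes a partial homotopy for the identity. *)
Lemma wedge_homotopy (h : R -> R) i f (T : {set 'I_r}) :
  {morph h : a b / a + b} ->
  (forall s a, s != i -> h (y s * a) = y s * h a) ->
  d (wedge h i f) T + wedge h i (d f) T =
  if i \in T then h (y i * f T) else y i * h (f T).
Proof.
move=> hD hy; have h0 : h 0 = 0.
  by apply: (@addrI _ (h 0)); rewrite -hD !addr0.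
have hN a : h (- a) = - h a.
  by apply: (@addrI _ (h a)); rewrite -hD !subrr.
have hs s U a : h (ksign R s U * a) = ksign R s U * h a.
  by rewrite /ksign -signr_odd; case: odd; rewrite ?expr1 ?expr0 ?mulN1r ?mul1r.
rewrite [wedge h i (d f) T]ffunE kdE.
have [iT|iT] := boolP (i \in T); last first.
  rewrite addr0 (bigD1 i) //= big1 ?addr0 => [|s /andP[sT si]].
    rewrite ffunE setU11 setU1K // ksignU11.
    transitivity (ksign R i T * ksign R i T * (y i * h (f T))); first by ring.
    by rewrite ksignK mul1r.
  by rewrite ffunE !inE eq_sym (negbTE si) (negbTE iT) mulr0.
rewrite kdE (big_morph h hD h0) mulr_sumr addrC.
rewrite (bigD1 i) ?inE ?eqxx //= -[_ * y i * _]mulrA hs mulrA.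
rewrite ksignD11 ksignK mul1r setD1K //.
rewrite -addrA [X in _ + X](_ : _ = 0) ?addr0 //.
rewrite (eq_bigl (fun s => s \notin T)) => [|s]; last first.
  by rewrite !inE; case: eqP => [->|]; rewrite /= ?iT ?andbT.
rewrite -big_split big1 // => s sT /=.
have si : s != i by apply: contraNneq sT => ->.
rewrite ffunE in_setU1 iT orbT.
have -> : (s |: T) :\ i = s |: (T :\ i).
  apply/setP=> u; rewrite !inE; case: eqP => [->|] //=.
  by rewrite eq_sym (negbTE si).
rewrite -mulrA hs hy // ksignU1 //.
rewrite -[ksign R s (T :\ i)]mul1r -{1}[1](sqrr_sign _ (i < s)%N) expr2.
rewrite -[_ * _ * ksign _ _ _]mulrA.
have -> : (-1) ^+ (i < s)%N * ksign R s (T :\ i) = ksign R s T.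
  by rewrite -{2}(setD1K iT) ksignU1 // !inE eqxx.
have -> : (-1) ^+ (s < i)%N = - (-1) ^+ (i < s)%N :> R.
  case: (ltngtP s i) => [_|_|/ord_inj e]; rewrite ?expr1 ?expr0 ?opprK //.
  by rewrite e eqxx in si.
ring.
Qed.
End KoszulGeneral.

(** * Stanley-Reisner rings *)

Section Support.
Variable r : nat.
Implicit Types (m : 'X_{1..r}) (A B T : {set 'I_r}).

Definition msup m : {set 'I_r} := [set i | (0 < m i)%N].

Lemma mesym1E A i : mesym1 A i = (i \in A).
Proof. by rewrite mnmE. Qed.

Lemma msup_mesym1 A : msup (mesym1 A) = A.
Proof. by apply/setP=> i; rewrite inE mesym1E; case: (i \in A). Qed.

Lemma msup0 : msup 0%MM = set0.
Proof. by apply/setP=> i; rewrite !inE mnm0E. Qed.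

Lemma mesym1U1 s A : s \notin A -> mesym1 (s |: A) = (U_(s) + mesym1 A)%MM.
Proof.
move=> sA; apply/mnmP=> i; rewrite mnmDE mnm1E !mesym1E !inE eq_sym.
by case: eqP => [<-|] //=; rewrite (negbTE sA).
Qed.

Lemma mesym1_setD T A : T \subset A ->
  mesym1 A = (mesym1 (A :\: T) + mesym1 T)%MM.
Proof.
move/subsetP=> TA; apply/mnmP=> i; rewrite mnmDE !mesym1E !inE.
by case: (boolP (i \in T)) => [/TA->|] //=; rewrite ?addn0.
Qed.
End Support.

(* [R] is the Stanley-Reisner ring, over [k], of the simplicial complex [face],
   with variables [y]: the monomials whose support is a face form a basis, and
   [cf] gives the coordinates on it. [mon A] is the product of the variables in
   [A], and [quo i] divides by [y i] the monomials that are multiples of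
   [y i ^+ 2] and kills the other ones. *)
Record stanley_reisner (k : fieldType) (R : comNzRingType) (r : nat)
    (iota : k -> R) (y : 'I_r -> R) := StanleyReisner {
  face : pred {set 'I_r};
  cf : R -> 'X_{1..r} -> k;
  mon : {set 'I_r} -> R;
  quo : 'I_r -> R -> R;
  face0 : face set0;
  face1 : forall i, face [set i];
  faceS : forall A B : {set 'I_r}, A \subset B -> face B -> face A;
  cfD : forall x z m, cf (x + z) m = cf x m + cf z m;
  cf1 : forall m, cf 1 m = (m == 0%MM)%:R;
  cf_const : forall c x m, cf (iota c * x) m = c * cf x m;
  cf_var : forall s x m, cf (y s * x) m =
    if (0 < m s)%N && face (msup m) then cf x (m - U_(s))%MM else 0;
  cf_inj : forall x, (forall m, cf x m = 0) -> x = 0;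
  cf_mon : forall A m, cf (mon A) m = ((m == mesym1 A) && face A)%:R;
  cf_quo : forall i x m,
    cf (quo i x) m = if (0 < m i)%N then cf x (m + U_(i))%MM else 0;
  cf_mul : forall x z m, cf (x * z) m != 0 ->
    exists m1 m2, [/\ m = (m1 + m2)%MM, cf x m1 != 0 & cf z m2 != 0];
  cf_face : forall x m, cf x m != 0 -> face (msup m);
  cf_aug : forall x, cf x 0%MM = 0 -> exists f, x = \sum_i f i * y i
}.

(** The hypothesis on the ideal read off on squarefree monomials: if i |: A is not a face, x_A is a
    derivative with respect to x_i of an element of the ideal, and disjointness makes x_A x_B
    squarefree. *)
Definition golod_complex (r : nat) (face : pred {set 'I_r}) : Prop :=
  forall (i j : 'I_r) (A B : {set 'I_r}), i != j -> [disjoint A & B] ->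
  i \notin A -> j \notin B -> ~~ face (i |: A) -> ~~ face (j |: B) ->
  ~~ face (A :|: B).

Section StanleyReisnerTheory.
Variables (k : fieldType) (R : comNzRingType) (r : nat).
Variables (iota : k -> R) (y : 'I_r -> R) (P : stanley_reisner iota y).
Local Notation face := (face P).
Local Notation cf := (cf P).
Local Notation mon := (mon P).
Local Notation quo := (quo P).
Local Notation K := (koszul R r).
Local Notation d := (koszul_diff y).
Implicit Types (x z : R) (m : 'X_{1..r}) (A B S T U : {set 'I_r}).
Implicit Types (i j s t : 'I_r) (f g : K).

Lemma natb_neq0 (b : bool) : (b%:R != 0 :> k) = b.
Proof. by case: b; rewrite ?oner_eq0 ?eqxx. Qed.

Lemma cf0 m : cf 0 m = 0.
Proof. by apply: (@addrI _ (cf 0 m)); rewrite -cfD !addr0. Qed.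

Lemma cfN x m : cf (- x) m = - cf x m.
Proof. by apply: (@addrI _ (cf x m)); rewrite -cfD !subrr cf0. Qed.

Lemma cfB x z m : cf (x - z) m = cf x m - cf z m.
Proof. by rewrite cfD cfN. Qed.

Lemma cf_sum (J : Type) (l : seq J) (Q : pred J) (F : J -> R) m :
  cf (\sum_(j <- l | Q j) F j) m = \sum_(j <- l | Q j) cf (F j) m.
Proof. by apply: (big_morph (cf^~ m)) => [x z|]; rewrite ?cfD ?cf0. Qed.

Lemma cf_eq x z : (forall m, cf x m = cf z m) -> x = z.
Proof.
by move=> e; apply/subr0_eq/(@cf_inj _ _ _ _ _ P)=> m; rewrite cfB e subrr.
Qed.

Lemma cf_sign n x m : cf ((-1) ^+ n * x) m = (-1) ^+ n * cf x m.
Proof.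
by rewrite -signr_odd -[in RHS]signr_odd; case: odd; rewrite ?mulN1r ?cfN ?mul1r.
Qed.

Lemma cf_iota c m : cf (iota c) m = c * (m == 0%MM)%:R.
Proof. by rewrite -[iota c]mulr1 cf_const cf1. Qed.

Lemma cf_y s m : cf (y s) m = (m == U_(s)%MM)%:R.
Proof.
rewrite -[y s]mulr1 cf_var cf1.
have [->|ms] := eqVneq m U_(s)%MM.
  rewrite mnm1E eqxx -mesym1_set1 msup_mesym1 face1 mesym1_set1.
  by rewrite -{1}(add0m U_(s)%MM) addmK eqxx.
case: ifP => // /andP[m0 _]; case: eqP => // e; case/eqP: ms.
apply/mnmP=> i; move/mnmP/(_ i): e; rewrite mnmBE mnm0E mnm1E.
by case: eqP => [<-|_]; lia.
Qed.

Lemma iota0 : iota 0 = 0.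
Proof. by apply: cf_eq => m; rewrite cf_iota cf0 mul0r. Qed.

Lemma iotaD c e : iota (c + e) = iota c + iota e.
Proof. by apply: cf_eq => m; rewrite cfD !cf_iota mulrDl. Qed.

Lemma iota1 : iota 1 = 1.
Proof. by apply: cf_eq => m; rewrite cf_iota cf1 mul1r. Qed.

Lemma iotaM c e : iota (c * e) = iota c * iota e.
Proof. by apply: cf_eq => m; rewrite cf_const !cf_iota mulrA. Qed.

Lemma iotaN c : iota (- c) = - iota c.
Proof. by apply: cf_eq => m; rewrite cfN !cf_iota mulNr. Qed.

Lemma iota_sum (J : Type) (l : seq J) (Q : pred J) (F : J -> k) :
  iota (\sum_(j <- l | Q j) F j) = \sum_(j <- l | Q j) iota (F j).
Proof. exact: (big_morph _ iotaD iota0). Qed.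

Lemma iota_sign n : iota ((-1) ^+ n) = (-1) ^+ n.
Proof.
rewrite -signr_odd -[in RHS]signr_odd.
by case: odd; rewrite ?expr1 ?expr0 ?iotaN iota1.
Qed.

Lemma quoD i : {morph quo i : x z / x + z}.
Proof.
move=> x z; apply: cf_eq => m; rewrite cfD !cf_quo.
by case: ifP => _; rewrite ?cfD ?addr0.
Qed.

(** Dividing a multiple of y_i^2 by y_i keeps its support, hence does not change whether that
    support is a face. Dividing y_s y_i by y_i would not be compatible: y_s y_i may be zero while
    y_s is not. *)
Lemma quo_var i s x : s != i -> quo i (y s * x) = y s * quo i x.
Proof.
move=> si; apply: cf_eq => m; rewrite cf_quo !cf_var cf_quo.
rewrite mnmBE mnmDE !mnm1E [i == s]eq_sym (negbTE si) addn0 subn0.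
case: (ltnP 0 (m i)) => mi /=; last by case: ifP.
have -> : msup (m + U_(i))%MM = msup m.
  apply/setP=> j; rewrite !inE mnmDE mnm1E.
  by case: eqP => [<-|_]; rewrite ?mi ?addn0 // addn1.
case: ifP => // /andP[ms _]; congr (cf x _); apply/mnmP=> j.
by rewrite !(mnmDE, mnmBE, mnm1E); case: eqP => [<-|]; lia.
Qed.

Lemma mon_var s A : s \notin A -> y s * mon A = mon (s |: A).
Proof.
move=> sA; apply: cf_eq => m; rewrite cf_var !cf_mon mesym1U1 //.
have [->|ms] := eqVneq m (U_(s) + mesym1 A)%MM.
  rewrite -mesym1U1 // msup_mesym1 mesym1E setU11 mesym1U1 //= addmC addmK.
  rewrite eqxx /=.
  case: (boolP (face (s |: A))) => // fA.
  by rewrite (faceS _ fA) // subsetUr.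
case: ifP => // /andP[m0 _]; case: eqP => //= e; case/eqP: ms.
rewrite -e addmC submK //; apply/mnm_lepP=> i.
by rewrite mnm1E; case: eqP => // <-.
Qed.

Lemma mon_mul0 A B : ~~ face (A :|: B) -> mon A * mon B = 0.
Proof.
move=> nf; apply: (@cf_inj _ _ _ _ _ P) => m; apply: contraNeq nf => cm.
have := cf_face cm; case/cf_mul: cm => m1 [m2 []] ->.
rewrite !cf_mon !natb_neq0 => /andP[/eqP-> _] /andP[/eqP-> _].
rewrite (_ : msup _ = A :|: B) //.
apply/setP=> i; rewrite !inE mnmDE !mesym1E.
by do 2!case: (i \in _).
Qed.

Lemma mon_nface A : ~~ face A -> mon A = 0.
Proof.
by move=> nf; apply: (@cf_inj _ _ _ _ _ P) => m; rewrite cf_mon (negbTE nf) andbF.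
Qed.

Lemma cf_koszul_diff f T m :
  cf (d f T) m = \sum_(s | s \notin T) ksign k s T *
    (if (0 < m s)%N && face (msup m) then cf (f (s |: T)) (m - U_(s))%MM else 0).
Proof.
rewrite kdE cf_sum; apply: eq_bigr => s _.
by rewrite -mulrA cf_sign cf_var.
Qed.

Definition sigma i := wedge (quo i) i.

Lemma sigma_homotopy i f T :
  d (sigma i f) T + sigma i (d f) T =
  if i \in T then quo i (y i * f T) else y i * quo i (f T).
Proof.
by apply: wedge_homotopy => [|s x /quo_var]; [apply: quoD | apply].
Qed.

(** The sum m i + (i \in T) is the exponent of y_i in the multidegree, e_i counting for one. So the
    homotopy is the projection onto the multidegrees divisible by y_i^2. *)
Lemma cf_homotopy i f T m :
  cf (d (sigma i f) T + sigma i (d f) T) m =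
  if (2 <= m i + (i \in T))%N then cf (f T) m else 0.
Proof.
rewrite sigma_homotopy; case: ifP => iT; rewrite ?cf_quo ?cf_var ?cf_quo.
  rewrite mnmDE mnm1E eqxx !addn1 [(1 < _)%N]ltnS; case: ltnP => //= mi.
  have -> : msup (m + U_(i))%MM = msup m.
    by apply/setP=> j; rewrite !inE mnmDE mnm1E; case: eqP => [<-|]; lia.
  rewrite addmK; case: ifP => // nf.
  have [->//|/cf_face] := eqVneq (cf (f T) m) 0.
  by rewrite nf.
rewrite mnmBE mnm1E eqxx addn0; case: (ltnP 1 (m i)) => mi; last first.
  by rewrite (_ : (0 < m i - 1)%N = false) ?if_same //; lia.
rewrite subn_gt0 mi submK; last first.
  by apply/mnm_lepP=> j; rewrite mnm1E; case: eqP => [<-|]; lia.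
case: ifP => //; have [->//|/cf_face ->] := eqVneq (cf (f T) m) 0.
by rewrite andbT; lia.
Qed.

Lemma quo0 i : quo i 0 = 0.
Proof. by apply: cf_eq => m; rewrite cf_quo !cf0 if_same. Qed.

Lemma sigma0 i : sigma i 0 = 0.
Proof. by apply/ffunP=> T; rewrite !ffunE quo0 mulr0 if_same. Qed.

Lemma sigma_deg i (j : nat) f : koszul_deg j f -> koszul_deg j.+1 (sigma i f).
Proof.
move=> df S Sj; rewrite ffunE; case: ifP => // iS.
by rewrite df ?quo0 ?mulr0 //; move: Sj; rewrite (cardsD1 i) iS add1n eqSS.
Qed.

End StanleyReisnerTheory.

(** * Squarefree Koszul chains *)

Section ScalarComplex.
Variables (k : fieldType) (r : nat) (face : pred {set 'I_r}).
Local Notation Kk := (koszul k r).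
Implicit Types (A B S T U : {set 'I_r}) (i s t : 'I_r) (c : Kk) (j : nat).

Definition kd1 : Kk -> Kk := koszul_diff (fun _ => 1).

Lemma kd1_linear : linear kd1.
Proof. by move=> a u v; rewrite /kd1 kdD kdZ. Qed.
HB.instance Definition _ := GRing.isLinear.Build k Kk Kk *:%R kd1 kd1_linear.

Definition restr (Q : pred {set 'I_r}) c : Kk :=
  [ffun T => if Q T then c T else 0].

Lemma restr_linear Q : linear (restr Q).
Proof.
move=> a u v; apply/ffunP=> T; rewrite !ffunE.
by case: ifP => _; rewrite ?addr0 // /GRing.scale /= mulr0.
Qed.
HB.instance Definition _ Q :=
  GRing.isLinear.Build k Kk Kk *:%R (restr Q) (restr_linear Q).

Definition nonfaces U j : pred {set 'I_r} :=
  [pred T : {set 'I_r} | [&& T \subset U, ~~ face (U :\: T) & #|T| == j]].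

(* A scalar chain [c] on subsets of [U] stands for the sum of the
   [c T x^(U \ T) e_T], an element of multidegree [U] of the Koszul complex of
   the polynomial ring; those with coefficients in the ideal form [nfchains]. *)
Definition nfchains U j : {vspace Kk} := limg (linfun (restr (nonfaces U j))).

Lemma nfchainsP U j c :
  reflect (forall T, c T != 0 -> nonfaces U j T) (c \in nfchains U j).
Proof.
apply: (iffP idP) => [/memv_imgP[e _ ->] T|H].
  by rewrite lfunE ffunE; case: ifP => //; rewrite eqxx.
apply/memv_imgP; exists c; rewrite ?memvf // lfunE; apply/ffunP=> T.
by rewrite ffunE; case: ifPn => // nT; apply/eqP; apply: contraNT nT => /H.
Qed.

(* By the connecting map, the part of multidegree [U] of H_(j+1) of the Koszul
   complex of the quotient is H_j of the chains with coefficients in the ideal;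
   [nfhom] is a space of representatives of the latter. *)
Definition nfhom U j : {vspace Kk} :=
  (nfchains U j :&: lker (linfun kd1)) :\: (linfun kd1 @: nfchains U j.+1).

Definition nfhom_index (p : {set 'I_r} * 'I_r) : finType :=
  'I_(\dim (nfhom p.1 p.2)).
(** Letters index a basis of the Koszul homology in positive degrees. Bounding the second index by
    [r] loses nothing when the empty set is a face: a set T with U \ T not a face differs from U, so
    it has fewer than [r] elements. *)
Definition letter : finType := {p : {set 'I_r} * 'I_r & nfhom_index p}.
Definition lset (a : letter) : {set 'I_r} := (tag a).1.
Definition ldeg (a : letter) : nat := (tag a).2.+1.
Definition lvec (a : letter) : Kk :=
  (vbasis (nfhom (lset a) (tag a).2))`_(tagged a).
Implicit Types a : letter.

Lemma lvec_nfhom a : lvec a \in nfhom (lset a) (tag a).2.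
Proof. by apply: vbasis_mem; rewrite mem_nth ?size_tuple. Qed.

Lemma lvec_cap a :
  lvec a \in (nfchains (lset a) (tag a).2 :&: lker (linfun kd1))%VS.
Proof. by have := lvec_nfhom a; apply/subvP/diffvSl. Qed.

Lemma lvec_supp a T : lvec a T != 0 -> nonfaces (lset a) (tag a).2 T.
Proof. by have /memv_capP[/nfchainsP H _] := lvec_cap a; apply: H. Qed.

Lemma lvec_cycle a : kd1 (lvec a) = 0.
Proof.
have /memv_capP[_] := lvec_cap a.
by rewrite memv_ker lfunE => /eqP.
Qed.

Lemma lvec_neq0 a : lvec a != 0.
Proof.
apply: (@free_not0 _ _ _ (vbasis (nfhom (lset a) (tag a).2))).
  exact: basis_free (vbasisP _).
by rewrite mem_nth ?size_tuple.
Qed.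

Lemma letter_supp_ex a : exists T, nonfaces (lset a) (tag a).2 T.
Proof.
apply/existsP; apply: contraNT (lvec_neq0 a) => /existsPn H.
apply/eqP/ffunP=> T; rewrite [RHS]ffunE.
by apply/eqP; apply: contraNT (H T) => /lvec_supp.
Qed.

Lemma sum_letter (V : zmodType) (p : {set 'I_r} * 'I_r) (F : letter -> V) :
  \sum_(a | (lset a == p.1) && (ldeg a == p.2.+1)) F a =
  \sum_(l < \dim (nfhom p.1 p.2)) F (Tagged nfhom_index (l : nfhom_index p)).
Proof.
rewrite (eq_bigl (fun a : letter => (tag a == p) && true)) => [|a]; last first.
  by rewrite andbT /lset /ldeg eqSS val_eqE -pair_eqE.
have := @sig_big_dep V 0 +%R _ nfhom_index (pred1 p) (fun _ _ => true)
  (fun q l => F (Tagged nfhom_index l)).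
by rewrite (big_pred1 p) // => ->; apply: eq_bigr => -[].
Qed.

Lemma lvec_indep (U : {set 'I_r}) (j : 'I_r) (e : letter -> k) (c : Kk) :
  c \in nfchains U j.+1 ->
  \sum_(a | (lset a == U) && (ldeg a == j.+1)) e a *: lvec a = kd1 c ->
  forall a, lset a = U -> ldeg a = j.+1 -> e a = 0.
Proof.
move=> cL; rewrite (@sum_letter _ (U, j)) /= /lvec /lset /= => E.
have E0 : \sum_(l < \dim (nfhom U j))
    e (Tagged nfhom_index (l : nfhom_index (U, j))) *: (vbasis (nfhom U j))`_l = 0.
  apply/eqP; rewrite -memv0 -(capv_diff
    (nfchains U j :&: lker (linfun kd1)) (linfun kd1 @: nfchains U j.+1)).
  apply/memv_capP; split; last by rewrite E -lfunE memv_img.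
  by apply: memv_suml => l _; rewrite memvZ // vbasis_mem // mem_nth ?size_tuple.
move=> [[U' j'] l] /= eU ej; rewrite /ldeg /= in ej.
have {}ej : j' = j by apply: val_inj; case: ej.
rewrite /lset /= in eU; subst U' j'.
have /freeP/(_ _ E0 l) := basis_free (vbasisP (nfhom U j)).
by apply.
Qed.

Lemma lvec_span (U : {set 'I_r}) (j : 'I_r) (w : Kk) :
  w \in nfchains U j -> kd1 w = 0 ->
  exists e : letter -> k, exists2 c, c \in nfchains U j.+1 &
  w = \sum_(a | (lset a == U) && (ldeg a == j.+1)) e a *: lvec a + kd1 c.
Proof.
move=> wL dw.
have : w \in (nfhom U j + (linfun kd1 @: nfchains U j.+1))%VS.
  rewrite /nfhom addv_diff; apply/memv_addP; exists w.
    by apply/memv_capP; rewrite memv_ker lfunE /= dw.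
  by exists 0; rewrite ?mem0v ?addr0.
case/memv_addP => u uH [v /memv_imgP[c cL ->] ->].
exists (fun a => coord (vbasis (nfhom (tag a).1 (tag a).2)) (tagged a) u).
exists c => //; rewrite lfunE (@sum_letter _ (U, j)); congr (_ + _).
exact: (coord_vbasis uH).
Qed.

(** Multidegree of a word. In the homological degree [wdeg] each letter of Koszul degree j counts
    for j + 1, the shift that produces t^(j+1) in the denominator of the series. *)
Definition wbeta (w : seq letter) : 'X_{1..r} :=
  foldr (fun a m => (mesym1 (lset a) + m)%MM) 0%MM w.
Definition wdeg (w : seq letter) : nat :=
  foldr (fun a n => ((ldeg a).+1 + n)%N) 0%N w.
End ScalarComplex.

Arguments ldeg : simpl never.

(** * Koszul homology *)

Section KoszulHomology.
Variables (k : fieldType) (R : comNzRingType) (r : nat).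
Variables (iota : k -> R) (y : 'I_r -> R) (P : stanley_reisner iota y).
Local Notation face := (face P).
Local Notation cf := (cf P).
Local Notation mon := (mon P).
Local Notation K := (koszul R r).
Local Notation Kk := (koszul k r).
Local Notation d := (koszul_diff y).
Local Notation letter := (letter k face).
Implicit Types (x z : R) (m : 'X_{1..r}) (A B S T U : {set 'I_r}).
Implicit Types (i s t : 'I_r) (j : nat) (f g : K) (c : Kk) (a b : letter).

(** Image in the Koszul complex of R of the chain of multidegree U encoded by [c]; the terms whose
    coefficient is supported on a nonface disappear because [mon] is 0 there. *)
Definition real U c : K :=
  [ffun T : {set 'I_r} => if T \subset U then iota (c T) * mon (U :\: T) else 0].

Lemma realB U c c' : real U (c - c') = real U c - real U c'.
Proof.
apply/ffunP=> T; rewrite !ffunE; case: ifP => _; rewrite ?subr0 //.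
by rewrite (iotaD P) (iotaN P) mulrBl.
Qed.

Lemma realD U c c' : real U (c + c') = real U c + real U c'.
Proof.
apply/ffunP=> T; rewrite !ffunE; case: ifP => _; rewrite ?addr0 //.
by rewrite (iotaD P) mulrDl.
Qed.

Lemma real0 U : real U 0 = 0.
Proof. by have := realB U 0 0; rewrite !subrr. Qed.

Lemma realZ U (e : k) c : real U (e *: c) = iota e *: real U c.
Proof.
apply/ffunP=> T; rewrite !ffunE; case: ifP => _; rewrite /GRing.scale /= ?mulr0 //.
by rewrite (iotaM P) mulrA.
Qed.

Lemma real_sum (J : Type) (l : seq J) (Q : pred J) U (F : J -> Kk) :
  real U (\sum_(j <- l | Q j) F j) = \sum_(j <- l | Q j) real U (F j).
Proof. exact: (big_morph _ (realD U) (real0 U)). Qed.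

Lemma real_deg U c j : koszul_deg j c -> koszul_deg j (real U c).
Proof.
by move=> H S Sj; rewrite ffunE H // (iota0 P) mul0r if_same.
Qed.

Lemma d_real U c : (forall T, c T != 0 -> T \subset U) ->
  d (real U c) = real U (kd1 c).
Proof.
move=> cU; apply/ffunP=> T; rewrite kdE [RHS]ffunE.
have [TU|nTU] := boolP (T \subset U); last first.
  rewrite big1 // => s sT; rewrite ffunE; case: ifP => [sTU|]; rewrite ?mulr0 //.
  by case/negP: nTU; apply: subset_trans sTU; apply: subsetUr.
rewrite /kd1 kdE (iota_sum P) mulr_suml; apply: eq_bigr => s sT.
rewrite ffunE mulr1; have [sU|sU] := boolP (s \in U); last first.
  have nsU : ~~ (s |: T \subset U) by rewrite subUset sub1set (negbTE sU).
  rewrite (negbTE nsU) mulr0; have [->|/cU] := eqVneq (c (s |: T)) 0.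
    by rewrite mulr0 (iota0 P) mul0r.
  by rewrite (negbTE nsU).
rewrite subUset sub1set sU TU /= (iotaM P) (iota_sign P).
have e : s |: (U :\: (s |: T)) = U :\: T.
  by apply/setP=> t; rewrite !inE; case: eqP => [->|] //=; rewrite sT sU.
have sn : s \notin U :\: (s |: T) by rewrite !inE eqxx.
rewrite -e -(mon_var P sn) /ksign; ring.
Qed.

Lemma cf_real U c T m : cf (real U c T) m =
  if (T \subset U) && (m == mesym1 (U :\: T)) && face (U :\: T) then c T else 0.
Proof.
rewrite ffunE; case: ifP => _; last by rewrite (cf0 P).
rewrite cf_const cf_mon /=; by case: eqP => _; case: face; rewrite ?mulr1 ?mulr0.
Qed.

Definition sqc U f : Kk :=
  [ffun T : {set 'I_r} => if T \subset U then cf (f T) (mesym1 (U :\: T)) else 0].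

Lemma sqc_supp U f T : sqc U f T != 0 -> T \subset U.
Proof. by rewrite ffunE; case: ifP => //; rewrite eqxx. Qed.

Lemma sqc_deg U f j : koszul_deg j f -> koszul_deg j (sqc U f).
Proof. by move=> H S Sj; rewrite ffunE H // (cf0 P) if_same. Qed.

(** Restricted to faces because the scalar boundary may have terms at nonfaces, which R kills. This
    discrepancy is a chain with coefficients in the ideal and realizes the connecting map. *)
Lemma sqc_d U f T : T \subset U -> face (U :\: T) ->
  sqc U (d f) T = kd1 (sqc U f) T.
Proof.
move=> TU fT; rewrite ffunE TU (cf_koszul_diff P) /kd1 kdE.
apply: eq_bigr => s sT; rewrite mulr1; congr (_ * _).
rewrite mesym1E msup_mesym1 fT andbT !inE sT /= ffunE subUset sub1set TU andbT.
case: (boolP (s \in U)) => //= sU; congr (cf _ _); apply/mnmP=> t.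
rewrite mnmBE mnm1E !mesym1E !inE [s == t]eq_sym.
by case: eqP => [->|] /=; rewrite ?sT ?sU ?subn0.
Qed.

Lemma sqc_real U c T : T \subset U -> face (U :\: T) -> sqc U (real U c) T = c T.
Proof. by move=> TU fT; rewrite ffunE TU cf_real TU fT eqxx. Qed.

Lemma sqc_real_neq U U' c T : U' != U -> sqc U (real U' c) T = 0.
Proof.
move=> neU; rewrite ffunE; case: ifP => // TU; rewrite cf_real.
case: ifP => // /andP[/andP[TU' /eqP/inj_mesym1 e] _].
case/eqP: neU; apply/setP=> t; move/setP/(_ t): e; rewrite !inE.
by case: (boolP (t \in T)) => //= tT _; rewrite (subsetP TU) ?(subsetP TU').
Qed.

Lemma sqcD U f g : sqc U (f + g) = sqc U f + sqc U g.
Proof.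
by apply/ffunP=> T; rewrite !ffunE; case: ifP; rewrite ?addr0 // cfD.
Qed.

Lemma sqc0 U : sqc U 0 = 0.
Proof. by apply/ffunP=> T; rewrite !ffunE (cf0 P) if_same. Qed.

Lemma sqcZ U (e : k) f : sqc U (iota e *: f) = e *: sqc U f.
Proof.
apply/ffunP=> T; rewrite !ffunE; case: ifP; rewrite /GRing.scale /= ?mulr0 //.
by rewrite cf_const.
Qed.

Lemma sqc_sum (J : Type) (l : seq J) (Q : pred J) U (F : J -> K) :
  sqc U (\sum_(j <- l | Q j) F j) = \sum_(j <- l | Q j) sqc U (F j).
Proof. exact: (big_morph _ (sqcD U) (sqc0 U)). Qed.

Lemma real_nfchains U j c : c \in nfchains k face U j -> real U c = 0.
Proof.
move/nfchainsP=> H; apply/ffunP=> T; rewrite !ffunE; case: ifP => // TU.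
have [->|/H/and3P[_ nf _]] := eqVneq (c T) 0; first by rewrite (iota0 P) mul0r.
by rewrite (mon_nface nf) mulr0.
Qed.

Lemma nonfaces_neq0 U j T : nonfaces face U j T -> exists i, i \in U.
Proof.
case/and3P=> TU nf _; apply/set0Pn; apply: contraNneq nf => U0.
by rewrite (_ : U :\: T = set0) ?face0 // U0 set0D.
Qed.

(* A chain over the polynomial ring with boundary [lvec a]: its coefficients are
   derivatives, with respect to a variable of [lset a], of elements of the
   ideal. *)
Definition lprim a : Kk :=
  if [pick i in lset a] is Some i then wedge id i (lvec a) else 0.

Lemma lprimE a : exists2 i, i \in lset a & lprim a = wedge id i (lvec a).
Proof.
rewrite /lprim; case: pickP => [i iU|n]; first by exists i.
by have [T /nonfaces_neq0[i]] := letter_supp_ex a; rewrite n.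
Qed.

(** With every variable set to 1 the homotopy is one for the identity, so over the polynomial ring a
    nonempty squarefree multidegree is acyclic. *)
Lemma kd1_wedge i c : kd1 (wedge id i c) + wedge id i (kd1 c) = c.
Proof.
apply/ffunP=> T; rewrite [LHS]ffunE (@wedge_homotopy _ _ (fun _ => 1) id) //.
by rewrite mul1r if_same.
Qed.

Lemma wedge_id0 i : wedge id i (0 : Kk) = 0.
Proof. by apply/ffunP=> T; rewrite !ffunE mulr0 if_same. Qed.

Lemma kd1_lprim a : kd1 (lprim a) = lvec a.
Proof.
have [i _ ->] := lprimE a; have := kd1_wedge i (lvec a).
by rewrite lvec_cycle wedge_id0 addr0.
Qed.

Lemma lprim_supp a : exists2 i, i \in lset a & forall T, lprim a T != 0 ->
  i \in T /\ nonfaces face (lset a) (tag a).2 (T :\ i).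
Proof.
have [i iU ->] := lprimE a; exists i => // T; rewrite ffunE.
case: ifP => [iT|]; last by rewrite eqxx.
have [->|/lvec_supp] := eqVneq (lvec a (T :\ i)) 0; last by [].
by rewrite mulr0 eqxx.
Qed.

Lemma lprim_sub a T : lprim a T != 0 -> T \subset lset a.
Proof.
have [i iU H] := lprim_supp a; case/H=> iT /and3P[TU _ _].
by rewrite -(setD1K iT) subUset sub1set iU.
Qed.

Lemma lprim_deg a : koszul_deg (ldeg a) (lprim a).
Proof.
move=> T; apply: contraNeq; have [i iU H] := lprim_supp a.
by case/H=> iT /and3P[_ _ /eqP e]; rewrite (cardsD1 i) iT e.
Qed.

Definition lcyc a : K := real (lset a) (lprim a).

Lemma lcyc_deg a : koszul_deg (ldeg a) (lcyc a).
Proof. exact/real_deg/lprim_deg. Qed.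

Lemma lcyc_cycle a : d (lcyc a) = 0.
Proof.
rewrite d_real; last exact: lprim_sub.
rewrite kd1_lprim; apply: (@real_nfchains _ (tag a).2); apply/nfchainsP.
exact: lvec_supp.
Qed.

Lemma lcyc_hom a T m :
  cf (lcyc a T) m != 0 -> (m + mesym1 T)%MM = mesym1 (lset a).
Proof.
rewrite cf_real; case: ifP => [/andP[/andP[TU /eqP->] _] _|]; last by rewrite eqxx.
by rewrite -mesym1_setD.
Qed.

(** A nonface has at least two elements, since the empty set and the singletons are faces. This
    strict inequality is what makes the resolution minimal. *)
Lemma ldeg_lt a : (ldeg a < #|lset a|)%N.
Proof.
have [T /and3P[TU nf /eqP cT]] := letter_supp_ex a.
rewrite /ldeg -cT; have := cardsID T (lset a); rewrite (setIidPr TU) => <-.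
rewrite -addn2 leq_add2l ltnNge; apply: contraNN nf; rewrite leq_eqVlt.
case/orP=> [/cards1P[i ->]|]; first exact: face1.
by rewrite ltnS leqn0 cards_eq0 => /eqP ->; apply: face0.
Qed.

Hypothesis golodD : golod_complex face.

(** This is where the hypothesis on the complex acts. A nonzero coefficient of [lcyc a] at T is
    carried by U \ T, which becomes a nonface once the contracted variable i is added; likewise for
    [b] and j. Disjoint supports give i <> j. *)
Lemma lcyc_mul0 a b T T' : [disjoint lset a & lset b] ->
  lcyc a T * lcyc b T' = 0.
Proof.
move=> dab; rewrite !ffunE; case: ifP => TU; last by rewrite mul0r.
case: ifP => TU'; last by rewrite mulr0.
have [->|] := eqVneq (lprim a T) 0; first by rewrite (iota0 P) !mul0r.
have [i iU Ha] := lprim_supp a; case/Ha=> iT /and3P[_ nfa _].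
have [->|] := eqVneq (lprim b T') 0; first by rewrite (iota0 P) mul0r mulr0.
have [j jU Hb] := lprim_supp b; case/Hb=> jT /and3P[_ nfb _].
rewrite mulrACA (mon_mul0 (P := P)) ?mulr0 //.
have ij : i != j.
  by apply: contraTneq dab => e; apply/pred0Pn; exists i; rewrite /= iU e.
have sD (U T0 : {set 'I_r}) s : s \in U -> s \in T0 ->
    U :\: (T0 :\ s) = s |: (U :\: T0).
  move=> sU sT; apply/setP=> t; rewrite !inE.
  by case: eqP => [->|] //=; rewrite sU.
apply: (@golodD i j) => //; rewrite ?inE ?iT ?jT -?sD //.
by apply: disjointW dab; apply: subsetDl.
Qed.

(** Injectivity of the connecting map. In multidegree U the combination of primitives minus the
    boundary of the bounding chain vanishes on faces, so it has coefficients in the ideal; its own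
    boundary is the same combination of the [lvec], and [lvec_indep] applies. *)
Lemma lcyc_indep j (e : letter -> k) :
  koszul_bound y j (\sum_(a | ldeg a == j) iota (e a) *: lcyc a) ->
  forall a, ldeg a = j -> e a = 0.
Proof.
move=> [g [dg E]] a aj; pose U := lset a; pose jj := (tag a).2.
pose s : Kk := \sum_(b | (lset b == U) && (ldeg b == jj.+1)) e b *: lprim b.
pose c : Kk := s - kd1 (sqc U g).
have ejj : jj.+1 = j by rewrite -aj.
have cE T : T \subset U -> face (U :\: T) -> c T = 0.
  move=> TU fT; rewrite 2!ffunE -sqc_d // -E sqc_sum.
  apply/eqP; rewrite subr_eq0; apply/eqP.
  rewrite /s !sum_ffunE [RHS](bigID (fun b => lset b == U)) /=.
  rewrite [X in _ + X]big1 ?addr0 => [|b /andP[_ nU]]; last first.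
    by rewrite sqcZ ffunE sqc_real_neq // /GRing.scale /= mulr0.
  rewrite ejj; under [LHS]eq_bigl do rewrite andbC.
  apply: eq_bigr => b /andP[_ /eqP bU]; rewrite sqcZ ffunE [RHS]ffunE.
  by rewrite /lcyc bU sqc_real.
have cL : c \in nfchains k face U jj.+1.
  apply/nfchainsP=> T cT; have TU : T \subset U.
    apply: contraNT cT => nT; apply/eqP; rewrite 2!ffunE sum_ffunE.
    rewrite big1 => [|b /andP[/eqP bU _]]; last first.
      rewrite ffunE; have [->|/lprim_sub] := eqVneq (lprim b T) 0.
        by rewrite /GRing.scale /= mulr0.
      by rewrite bU (negbTE nT).
    rewrite add0r /kd1 kdE big1 ?oppr0 // => t tT.
    have [->|/sqc_supp] := eqVneq (sqc U g (t |: T)) 0; first by rewrite mulr0.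
    by rewrite subUset (negbTE nT) andbF.
  apply/and3P; split => //; first by apply: contraNN cT => /(cE _ TU)->.
  apply: contraNT cT => nT; apply/eqP; rewrite 2!ffunE sum_ffunE.
  rewrite big1 => [|b /andP[_ /eqP bj]]; last first.
    by rewrite ffunE lprim_deg ?bj // /GRing.scale /= mulr0.
  rewrite add0r (_ : kd1 _ T = 0) ?oppr0 //.
  by apply: (@kd_deg _ _ (fun _ => 1) jj.+1) nT; apply: sqc_deg; rewrite ejj.
apply: (lvec_indep (U := U) (j := jj) cL); last by rewrite ?aj.
  rewrite /c linearB /= [kd1 (kd1 _)]kdd subr0 /s linear_sum /=.
  by apply: eq_bigr => b _; rewrite linearZ /= kd1_lprim.
by [].
Qed.

(** The variables are treated one after another. On a cycle the homotopy for i removes exactly the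
    terms of exponent at least 2 in i and leaves the other coefficients alone, so the variables
    already treated stay squarefree. *)
Lemma squarefree_homologous j f : koszul_deg j f -> d f = 0 ->
  exists g, [/\ koszul_deg j.+1 g, koszul_deg j (f - d g) & forall T m,
    cf ((f - d g) T) m != 0 -> forall i, (m i + (i \in T) <= 1)%N].
Proof.
move=> df fcyc; suff [g [dg dfg H]] : exists g, [/\ koszul_deg j.+1 g,
    koszul_deg j (f - d g) & forall T m, cf ((f - d g) T) m != 0 ->
    forall i, i \in enum 'I_r -> (m i + (i \in T) <= 1)%N].
  by exists g; split=> // T m /H{}H i; apply: H; rewrite mem_enum.
elim: (enum 'I_r) => [|i l [g [dg dfg H]]].
  by exists 0; rewrite kd0 subr0; split=> // S _; rewrite ffunE.
have E : f - d (g + sigma P i (f - d g)) =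
    (f - d g) - (d (sigma P i (f - d g)) + sigma P i (d (f - d g))).
  have -> : d (f - d g) = 0 by rewrite kdB fcyc kdd subr0.
  by rewrite (sigma0 P) kdD addr0 opprD addrA.
exists (g + sigma P i (f - d g)); split.
- move=> S Sj; rewrite ffunE dg // add0r.
  by rewrite (sigma_deg P i dfg Sj).
- have dgs : koszul_deg j.+1 (g + sigma P i (f - d g)).
    by move=> T Tj; rewrite ffunE dg // add0r (sigma_deg P i dfg Tj).
  by move=> S Sj; rewrite 2!ffunE df // add0r (kd_deg y dgs Sj) oppr0.
move=> T m; rewrite E koszulB [(d _ + _) T]koszulD (cfB P) (cf_homotopy P).
case: ltnP => [_|mi]; first by rewrite subrr eqxx.
rewrite subr0 => /H{}H t; rewrite inE => /orP[/eqP->|/H] //.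
Qed.

Lemma squarefree_sum f :
  (forall T m, cf (f T) m != 0 -> forall i, (m i + (i \in T) <= 1)%N) ->
  f = \sum_U real U (sqc U f).
Proof.
move=> H; apply/ffunP=> T; apply: (cf_eq (P := P)) => m.
rewrite sum_ffunE (cf_sum P); pose U := msup m :|: T.
rewrite (bigD1 U) //= big1 ?addr0 => [|U' neU]; last first.
  rewrite cf_real; case: ifP => // /andP[/andP[TU' /eqP e] _]; case/eqP: neU.
  rewrite /U e msup_mesym1; apply/setP=> t; rewrite !inE.
  by case: (boolP (t \in T)) => [/(subsetP TU')->|] //=; rewrite orbF.
rewrite cf_real ffunE (subsetUr _ _ : T \subset U) /=.
have [c0|cm] := eqVneq (cf (f T) m) 0.
  by case: ifP => // /andP[/eqP <- _]; rewrite c0.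
have e : m = mesym1 (U :\: T).
  apply/mnmP=> i; have := H _ _ cm i; rewrite mesym1E !inE.
  by case: (i \in T); case: (m i) => [|[|]].
have fU : face (U :\: T) by rewrite -[U :\: T]msup_mesym1 -e (cf_face cm).
by rewrite fU -e eqxx.
Qed.

(** Surjectivity of the connecting map. The scalar boundary of the chain has coefficients in the
    ideal, hence is a combination of the [lvec] up to a boundary. After subtracting the
    corresponding primitives and the correction [l], which is 0 in R, a scalar cycle remains, and
    contraction makes it a boundary. *)
Lemma sqc_homologous U j f : (0 < j)%N -> koszul_deg j f -> d f = 0 ->
  exists eg : {ffun letter -> k} * K, koszul_deg j.+1 eg.2 /\
    real U (sqc U f) =
    \sum_(a | (ldeg a == j) && (lset a == U)) iota (eg.1 a) *: lcyc a + d eg.2.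
Proof.
move=> j0 df fcyc; pose c := sqc U f.
(* A nonzero coefficient is what provides both the bound j - 1 < r, required to index letters, and
   an element i of U by which to contract. *)
have [c0|] := eqVneq c 0.
  exists (0, 0); split => /=; first by move=> S _; rewrite ffunE.
  rewrite -/c c0 real0 kd0 big1 ?addr0 // => a _.
  by rewrite ffunE (iota0 P) scale0r.
have cdeg : koszul_deg j c by apply: sqc_deg.
move=> c_neq0; have [T cT] : exists T, c T != 0.
  apply/existsP; apply: contraNT c_neq0 => /existsPn H.
  by apply/eqP/ffunP=> T; rewrite [RHS]ffunE; apply/eqP/negPn/H.
have Tj : #|T| = j by apply/eqP; apply: contraNT cT => /cdeg->.
have jr : (j.-1 < r)%N by rewrite prednK // -Tj -[leqRHS]card_ord max_card.
have /set0Pn[i iT] : T != set0 by rewrite -card_gt0 Tj.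
have iU : i \in U by apply: subsetP iT; apply: sqc_supp cT.
pose jj : 'I_r := Ordinal jr.
have wL : kd1 c \in nfchains k face U jj.
  apply/nfchainsP=> S wS; have SU : S \subset U.
    apply: contraNT wS => nS; apply/eqP; rewrite /kd1 kdE big1 // => t tS.
    have [->|/sqc_supp] := eqVneq (c (t |: S)) 0; first by rewrite mulr0.
    by rewrite subUset (negbTE nS) andbF.
  apply/and3P; split => //.
    by apply: contraNN wS => fS; rewrite -sqc_d // fcyc sqc0 ffunE.
  apply: contraNT wS => nS; apply/eqP.
  by apply: (@kd_deg _ _ (fun _ => 1) j.-1) nS; rewrite prednK.
have [|e [l lL E]] := lvec_span wL; first exact: kdd.
pose s : Kk := \sum_(a | (lset a == U) && (ldeg a == jj.+1)) e a *: lprim a.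
pose h := c - s - l.
have dh : kd1 h = 0.
  rewrite /h !linearB /= E /s linear_sum /=.
  rewrite [X in _ - X - _](_ : _ =
    \sum_(a | (lset a == U) && (ldeg a == jj.+1)) e a *: lvec a).
    by rewrite addrAC addrK subrr.
  by apply: eq_bigr => a _; rewrite linearZ /= kd1_lprim.
have hE : h = kd1 (wedge id i h).
  by rewrite -{1}[h](kd1_wedge i) dh wedge_id0 addr0.
have /nfchainsP lsupp := lL.
have hsupp S : h S != 0 -> S \subset U /\ #|S| = j.
  move=> hS; suff /andP[-> /eqP->] : (S \subset U) && (#|S| == j) by [].
  apply: contraNT hS => nS; apply/eqP; rewrite /h !koszulB /s sum_ffunE.
  rewrite big1 => [|a /andP[/eqP aU /eqP aj]]; last first.
    rewrite ffunE; have [->|sS] := eqVneq (lprim a S) 0.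
      by rewrite /GRing.scale /= mulr0.
    case/negP: nS; rewrite -{1}aU lprim_sub //=.
    by apply: contraNT sS => nS; rewrite lprim_deg // aj prednK.
  have -> : c S = 0.
    apply/eqP; apply: contraNT nS => cS; rewrite (sqc_supp cS) /=.
    by apply: contraNT cS => /cdeg ->.
  have -> : l S = 0; last by rewrite !subr0.
  apply/eqP; apply: contraNT nS => /lsupp/and3P[-> _].
  by rewrite /= prednK.
have wsupp S : wedge id i h S != 0 -> S \subset U /\ #|S| = j.+1.
  rewrite ffunE; case: ifP => [iS|]; last by rewrite eqxx.
  have [->|/hsupp[SU Sj] _] := eqVneq (h (S :\ i)) 0; first by rewrite mulr0 eqxx.
  by rewrite (cardsD1 i) iS Sj -(setD1K iS) subUset sub1set iU.
exists ([ffun a => e a], real U (wedge id i h)); split => /=.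
  apply: real_deg => S; apply: contraNeq => /wsupp[_ ->] //.
rewrite d_real => [|S /wsupp[]//]; rewrite -hE -/c.
rewrite -{1}(subrK s c) -{1}(subrK l (c - s)) !realD -/h.
rewrite (real_nfchains lL) addr0 addrC; congr (_ + _).
rewrite /s real_sum (eq_bigl (fun a => (ldeg a == j) && (lset a == U))); last first.
  by move=> a; rewrite andbC /= prednK.
apply: eq_bigr => a /andP[_ /eqP aU]; rewrite realZ ffunE /lcyc aU //.
Qed.

Lemma lcyc_span j f : (0 < j)%N -> koszul_cycle y j f ->
  exists e : letter -> k,
    koszul_bound y j (f - \sum_(a | ldeg a == j) iota (e a) *: lcyc a).
Proof.
move=> j0 [df fcyc]; have [g [dg dfg H]] := squarefree_homologous df fcyc.
have f'cyc : d (f - d g) = 0 by rewrite kdB fcyc kdd subr0.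
have [eg HU] := fin_all_exists (fun U => sqc_homologous U j0 dfg f'cyc).
exists (fun a => (eg (lset a)).1 a), (g + \sum_U (eg U).2); split.
  move=> S Sj; rewrite ffunE dg // add0r sum_ffunE big1 // => U _.
  by have [-> //] := HU U.
rewrite kdD kd_sum; apply/eqP; rewrite subr_eq -addrA addrC -subr_eq; apply/eqP.
rewrite (squarefree_sum H) (partition_big (@lset _ _ _) predT) //= addrC -big_split /=.
apply: eq_bigr => U _; have [_ ->] := HU U; congr (_ + _).
by apply: eq_bigr => a /andP[_ /eqP ->].
Qed.
End KoszulHomology.

(** * Golod's resolution *)

Section ExteriorAction.
Variables (R : comNzRingType) (r : nat) (y : 'I_r -> R).
Local Notation K := (koszul R r).
Local Notation d := (koszul_diff y).
Implicit Types (S T : {set 'I_r}) (s t i : 'I_r) (f g : K) (l : seq 'I_r).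

Definition kbas S : K := [ffun T => (T == S)%:R].

Lemma sum_kbas (V : lmodType R) S (G : {set 'I_r} -> V) :
  \sum_T d (kbas S) T *: G T = \sum_(s in S) (ksign R s S * y s) *: G (S :\ s).
Proof.
transitivity (\sum_(T : {set 'I_r}) \sum_(s : 'I_r | (s \notin T) && (s |: T == S))
   (ksign R s S * y s) *: G (S :\ s)).
  apply: eq_bigr => T _; rewrite kdE scaler_suml big_mkcondr.
  apply: eq_bigr => s sT; rewrite ffunE; case: eqP => [<-|_].
    by rewrite mulr1 ksignU11 setU1K.
  by rewrite mulr0 scale0r.
rewrite (exchange_big_dep (mem S)) /=; last first.
  by move=> T s _ /andP[_ /eqP <-]; rewrite setU11.
apply: eq_bigr => s sS; rewrite (big_pred1 (S :\ s)) // => T /=.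
apply/andP/eqP => [[sT /eqP <-]|->]; first by rewrite setU1K.
by rewrite !inE eqxx setD1K.
Qed.

Lemma kbas_expand f : f = \sum_S f S *: kbas S.
Proof.
apply/ffunP=> T; rewrite sum_ffunE (bigD1 T) //= big1 ?addr0 => [|S nST].
  by rewrite !ffunE eqxx /GRing.scale /= mulr1.
by rewrite !ffunE eq_sym (negbTE nST) /GRing.scale /= mulr0.
Qed.

Lemma wedge_id_sum i (J : Type) (u : seq J) (Q : pred J) (c : J -> R) (F : J -> K) :
  wedge id i (\sum_(j <- u | Q j) c j *: F j) =
  \sum_(j <- u | Q j) c j *: wedge id i (F j).
Proof.
apply/ffunP=> T; rewrite ffunE !sum_ffunE; case: ifP => iT; last first.
  by rewrite big1 // => j _; rewrite !ffunE iT /GRing.scale /= mulr0.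
rewrite mulr_sumr; apply: eq_bigr => j _; rewrite !ffunE iT /GRing.scale /=.
by rewrite mulrCA.
Qed.

Lemma wedge_idN i f : wedge id i (- f) = - wedge id i f.
Proof.
by apply/ffunP=> T; rewrite !ffunE; case: ifP => _; rewrite ?oppr0 // mulrN.
Qed.

(* For [l] increasing, [(-1)^p e_(s_1) /\ ... /\ e_(s_p) /\ f], where
   s_1 < ... < s_p are the elements of [S] in [l]. *)
Definition extl l S f : K :=
  foldr (fun i g => if i \in S then - wedge id i g else g) f l.
Definition ext S f := extl (enum 'I_r) S f.

Lemma extl_D1 l s S f : s \notin l -> extl l (S :\ s) f = extl l S f.
Proof.
elim: l => //= i l IH; rewrite inE negb_or => /andP[si sl].
by rewrite !inE eq_sym (negbTE si) /= IH.
Qed.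

Lemma d_extl l S f : sorted ltn (map val l) -> d f = 0 ->
  d (extl l S f) = - \sum_(s <- l | s \in S)
    ((-1) ^+ count (fun t : 'I_r => (t \in S) && (t < s)%N) l * y s) *:
    extl l (S :\ s) f.
Proof.
move=> sl df; elim: l sl => [|s0 l IH] /=; first by rewrite big_nil oppr0.
rewrite (path_sortedE ltn_trans) => /andP[/allP lt0 /IH{}IH].
have lt0l t : t \in l -> (s0 < t)%N by move=> tl; apply: lt0; apply: map_f.
have s0l : s0 \notin l by apply/negP=> /lt0l; rewrite ltnn.
have neq t : t \in l -> t != s0 by apply: contraTneq => ->.
rewrite big_cons; case: ifP => s0S; last first.
  rewrite IH; congr (- _); rewrite big_seq_cond [RHS]big_seq_cond.
  by apply: eq_bigr => s /andP[sL sS]; rewrite !inE s0S andbF.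
have c0 : count (fun t : 'I_r => (t \in S) && (t < s0)%N) l = 0%N.
  apply/eqP; rewrite -leqn0 leqNgt -has_count; apply/hasPn=> t /lt0l.
  by rewrite negb_and -leqNgt => /ltnW ->; rewrite orbT.
rewrite ltnn andbF c0 !inE eqxx /= expr0 mul1r extl_D1 // kdN.
have -> : d (wedge id s0 (extl l S f)) =
    y s0 *: extl l S f - wedge id s0 (d (extl l S f)).
  apply/ffunP=> T; have /= := @wedge_homotopy _ _ y id s0 (extl l S f) T.
  rewrite if_same => H; set g := wedge id s0 (d _).
  by rewrite [RHS]ffunE [X in X + _]ffunE [X in _ + X]ffunE -[_ *: _]H // addrK.
rewrite IH wedge_idN wedge_id_sum opprK; congr (- (_ + _)).
rewrite big_seq_cond [RHS]big_seq_cond; apply: eq_bigr => s /andP[sl' _].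
rewrite !inE eq_sym neq // s0S /= lt0l // add1n exprS mulN1r mulNr scaleNr.
by rewrite scalerN opprK.
Qed.

(** The Leibniz rule for a cycle f. The sign built into [extl] turns it into the relation d(phi) = -
    dsum(phi) for the empty word, the start of the induction in [phi_spec]. *)
Lemma d_ext S f : d f = 0 ->
  d (ext S f) = - \sum_T d (kbas S) T *: ext T f.
Proof.
move=> df; rewrite sum_kbas /ext d_extl //; last first.
  by rewrite val_enum_ord iota_ltn_sorted.
congr (- _); rewrite big_enum_cond; apply: eq_bigr => s _.
by rewrite -sum1_count big_enum_cond /= sum1dep_card.
Qed.

(** The coefficients of [ext S f] are 0 or, up to sign, coefficients of f. This reduces products of
    values of [phi] on empty words to products of cycles. *)
Lemma ext_annih (x : R) S f : (forall T, x * f T = 0) ->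
  forall T, x * ext S f T = 0.
Proof.
move=> xf; rewrite /ext; elim: (enum 'I_r) => //= i l IH T.
case: ifP => // _; rewrite !ffunE; case: ifP => _; last by rewrite oppr0 mulr0.
by rewrite mulrN mulrCA IH mulr0 oppr0.
Qed.
End ExteriorAction.

Import GRing.Theory.


(** * The differential on the words *)

Section Differential.
Variables (R : comNzRingType) (r : nat) (y : 'I_r -> R) (A : Type).
Local Notation K := (koszul R r).
Local Notation d := (koszul_diff y).
Implicit Types (S T : {set 'I_r}) (a b : A) (v w : seq A).
Variable phi : A -> {set 'I_r} -> seq A -> K.

(* The resolution has the basis [(S, w)], standing for [e_S (x) w] where the
   head of [w] is its last letter; an element of a free module is described by
   its image under the linear map taking the values [G] on the basis, and
   [dsum S w G] is the image of the differential of [(S, w)]: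
   d(S, a :: w) = d(S, w) (x) a + phi a S w. *)
Fixpoint dsum (V : lmodType R) S w (G : {set 'I_r} -> seq A -> V) : V :=
  match w with
  | [::] => \sum_T d (kbas R S) T *: G T [::]
  | a :: w' =>
    \sum_T phi a S w' T *: G T [::] + dsum S w' (fun T v => G T (a :: v))
  end.

Lemma dsum_morph (V W : lmodType R) (h : {linear V -> W}) S w G :
  h (dsum S w G) = dsum S w (fun T v => h (G T v)).
Proof.
elim: w G => [|a w IH] G /=.
  by rewrite linear_sum; apply: eq_bigr => T _; rewrite linearZ.
rewrite linearD IH linear_sum; congr (_ + _).
by apply: eq_bigr => T _; rewrite linearZ.
Qed.

Lemma dsumD (V : lmodType R) S w (G G' : _ -> _ -> V) :
  dsum S w (fun T v => G T v + G' T v) = dsum S w G + dsum S w G'.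
Proof.
elim: w G G' => [|a w IH] G G' /=.
  by rewrite -big_split; apply: eq_bigr => T _; rewrite scalerDr.
rewrite IH addrACA -big_split; congr (_ + _).
by apply: eq_bigr => T _; rewrite scalerDr.
Qed.

Lemma dsumN (V : lmodType R) S w (G : _ -> _ -> V) :
  dsum S w (fun T v => - G T v) = - dsum S w G.
Proof.
elim: w G => [|a w IH] G /=; rewrite ?IH ?opprD -sumrN.
  by apply: eq_bigr => T _; rewrite scalerN.
by congr (_ + _); apply: eq_bigr => T _; rewrite scalerN.
Qed.

(* A well-founded order for which the terms of the differential of [(S, w)]
   are smaller than [(S, w)]. *)
Definition wmu S w := (size w * r.+1 + #|S|)%N.

Lemma wmu_size S T v w : (size v < size w)%N -> (wmu T v < wmu S w)%N.
Proof.
move=> vw; rewrite /wmu; have Tr : (#|T| <= r)%N.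
  by rewrite -[leqRHS]card_ord max_card.
have : ((size v).+1 * r.+1 <= size w * r.+1)%N by rewrite leq_mul2r vw orbT.
by rewrite mulSn; lia.
Qed.

Lemma wmu_cons a S T v w :
  (wmu T (a :: v) < wmu S (a :: w))%N = (wmu T v < wmu S w)%N.
Proof. by rewrite /wmu /=; lia. Qed.

Lemma d_kbas S T : d (kbas R S) T =
  \sum_(s in S) (ksign R s S * y s) *: ((S :\ s == T)%:R : R^o).
Proof.
rewrite -(@sum_kbas _ _ y _ S (fun U => (U == T)%:R : R^o)).
rewrite (bigD1 T) //= eqxx big1 ?addr0 => [|U nU].
  by rewrite /GRing.scale /= mulr1.
by rewrite (negbTE nU) scaler0.
Qed.

Lemma d_kbas1 i T : d (kbas R [set i]) T = (T == set0)%:R * y i.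
Proof.
rewrite d_kbas big_set1 (_ : [set i] :\ i = set0); last first.
  by apply/setP=> j; rewrite !inE andNb.
rewrite /ksign eq_card0 => [|j]; last first.
  by rewrite !inE; case: eqP => // ->; rewrite ltnn.
by rewrite expr0 mul1r eq_sym /GRing.scale /= mulrC.
Qed.

Lemma kbas_neq0 S T : d (kbas R S) T != 0 ->
  exists2 s, s \in S & T = S :\ s /\ d (kbas R S) T = ksign R s S * y s.
Proof.
rewrite d_kbas.
have [/existsP[s /andP[sS /eqP <-]] _|/existsPn H] :=
    boolP [exists s, (s \in S) && (S :\ s == T)].
  exists s => //; split => //; rewrite (bigD1 s) //= eqxx big1 ?addr0.
    by rewrite /GRing.scale /= mulr1.
  move=> t /andP[tS ts]; case: eqP => [/setP/(_ s)|_]; rewrite ?scaler0 //.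
  by rewrite !inE eqxx eq_sym ts sS.
rewrite big1 ?eqxx // => s sS; have := H s; rewrite sS /=.
by move/negbTE->; rewrite scaler0.
Qed.

Lemma eq_dsum (V : lmodType R) S w (G G' : _ -> _ -> V) :
  (forall T v, (wmu T v < wmu S w)%N -> G T v = G' T v) ->
  dsum S w G = dsum S w G'.
Proof.
elim: w G G' => [|a w IH] G G' H /=.
  rewrite !sum_kbas; apply: eq_bigr => s sS.
  by rewrite H // /wmu /= !mul0n (cardsD1 s S) sS.
rewrite (IH _ (fun T v => G' T (a :: v))) => [|T v vw]; last first.
  by apply: H; rewrite wmu_cons.
by congr (_ + _); apply: eq_bigr => T _; rewrite H // wmu_size.
Qed.

(** The square of the differential on (S, a :: w) has two parts: its terms ending in a are the
    square on (S, w), zero by induction, and its Koszul part is d(phi a S w) plus phi a applied to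
    the differential of (S, w). The hypothesis says that these last two cancel. *)
Lemma dsum_dsum (V : lmodType R) S w (G : _ -> _ -> V) :
  (forall b v, (wmu S v < wmu S w)%N -> d (phi b S v) = - dsum S v (phi b)) ->
  dsum S w (fun T v => dsum T v G) = 0.
Proof.
elim: w G => [|a w IH] G H /=.
  have E T U : d (kbas R S) T *: (d (kbas R T) U *: G U [::]) =
    (d (kbas R S) T *: d (kbas R T)) U *: G U [::].
    have -> (c : R) (f : K) : (c *: f) U = c * f U by rewrite ffunE.
    by rewrite scalerA.
  under eq_bigr => T _ do
    [rewrite scaler_sumr; under eq_bigr => U _ do rewrite E].
  rewrite exchange_big big1 // => U _ /=.
  rewrite -scaler_suml -sum_ffunE -(eq_bigr _ (fun T _ => kdZ y _ _)) -kd_sum.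
  by rewrite -kbas_expand kdd ffunE scale0r.
have aw : (wmu S w < wmu S (a :: w))%N by rewrite wmu_size.
pose L (f : K) : V := \sum_U f U *: G U [::].
have Llin : linear L.
  move=> c u v; rewrite /L scaler_sumr -big_split; apply: eq_bigr => U _ /=.
  by rewrite !ffunE scalerDl scalerA.
pose LL := GRing.isLinear.Build R K V *:%R L Llin.
pose LP : {linear K -> V} := HB.pack L LL.
have E1 : \sum_T phi a S w T *: (\sum_U d (kbas R T) U *: G U [::]) =
    LP (d (phi a S w)).
  rewrite {2}[phi a S w]kbas_expand kd_sum linear_sum; apply: eq_bigr => T _.
  by rewrite kdZ linearZ.
rewrite E1 dsumD (_ : dsum S w (fun T v => _) = LP (dsum S w (phi a))); last first.
  by rewrite dsum_morph.
rewrite H // linearN /= addrA addNr add0r; apply: IH => b v vw; apply: H.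
exact: ltn_trans vw aw.
Qed.
End Differential.

Import GRing.Theory.


Lemma eq_dsum_phi (R : comNzRingType) (r : nat) (y : 'I_r -> R) (A : Type)
    (phi phi' : A -> {set 'I_r} -> seq A -> koszul R r) (V : lmodType R)
    (S : {set 'I_r}) (w : seq A) (G : _ -> _ -> V) :
  (forall b v, (wmu S v < wmu S w)%N -> phi b S v = phi' b S v) ->
  dsum y phi S w G = dsum y phi' S w G.
Proof.
elim: w G => [|a w IH] G H //=; rewrite H ?wmu_size // IH // => b v vw.
by apply: H; apply: ltn_trans vw _; rewrite wmu_size.
Qed.

(** * The trivial Massey operation *)

Section MasseyOperations.
Variables (k : fieldType) (R : comNzRingType) (r : nat).
Variables (iota : k -> R) (y : 'I_r -> R) (P : stanley_reisner iota y).
Local Notation face := (face P).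
Local Notation cf := (cf P).
Local Notation K := (koszul R r).
Local Notation d := (koszul_diff y).
Local Notation letter := (letter k face).
Implicit Types (x z : R) (m : 'X_{1..r}) (S T U : {set 'I_r}).
Implicit Types (i s t : 'I_r) (j : nat) (f g : K).
Implicit Types (a b : letter) (v w : seq letter).

Definition graded (al : 'X_{1..r}) j f := forall T m, cf (f T) m != 0 ->
  (m + mesym1 T)%MM = al /\ #|T| = j.

Lemma graded0 al j : graded al j 0.
Proof. by move=> T m; rewrite ffunE (cf0 P) eqxx. Qed.

Lemma gradedD al j f g : graded al j f -> graded al j g -> graded al j (f + g).
Proof.
move=> gf gg T m; rewrite ffunE cfD.
have [->|/gf //] := eqVneq (cf (f T) m) 0; rewrite add0r; exact: gg.
Qed.

Lemma graded_sum (J : Type) (l : seq J) (Q : pred J) (F : J -> K) al j :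
  (forall u, Q u -> graded al j (F u)) -> graded al j (\sum_(u <- l | Q u) F u).
Proof.
by move=> H; elim/big_ind: _ => // *; [apply: graded0 | apply: gradedD].
Qed.

Lemma gradedN al j f : graded al j f -> graded al j (- f).
Proof. by move=> gf T m; rewrite ffunE (cfN P) oppr_eq0; apply: gf. Qed.

Lemma gradedZ x al be j f : (forall m, cf x m != 0 -> (m + be)%MM = al) ->
  graded be j f -> graded al j (x *: f).
Proof.
move=> gx gf T m; rewrite ffunE => /cf_mul[m1 [m2 [-> /gx <- /gf[<- <-]]]].
by rewrite addmA.
Qed.

Lemma graded_deg al j f : graded al j f -> koszul_deg j f.
Proof.
move=> gf T Tj; apply: (@cf_inj _ _ _ _ _ P) => m.
by apply: contraNeq Tj => /gf[_ ->].
Qed.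

Lemma extl_graded l S al j f : graded al j f ->
  graded (\sum_(i <- l | i \in S) U_(i) + al)%MM
    (count (fun i => i \in S) l + j) (extl l S f).
Proof.
move=> gf; elim: l => [|i l IH] /=; first by rewrite big_nil add0m.
rewrite big_cons; case: ifP => iS; last by rewrite add0n.
apply: gradedN => T m; rewrite ffunE; case: ifP => [iT|]; last first.
  by rewrite (cf0 P) eqxx.
rewrite (cf_sign P) mulf_eq0 signr_eq0 /= => /IH[e e2]; split.
  rewrite -(setD1K iT) mesym1U1 ?inE ?eqxx //.
  by rewrite addmA [(m + _)%MM]addmC -addmA e addmA.
by rewrite (cardsD1 i) iT e2 addnA.
Qed.

Lemma ext_graded S al j f : graded al j f ->
  graded (mesym1 S + al)%MM (#|S| + j) (ext S f).
Proof.
move=> gf; have := @extl_graded (enum 'I_r) S _ _ _ gf.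
rewrite -sum1_count !big_enum_cond /= sum1_card.
rewrite (_ : (\sum_(i in S) U_(i))%MM = mesym1 S) //; apply/mnmP=> i.
rewrite mnm_sumE mesym1E; under eq_bigr do rewrite mnm1E.
have [iS|iS] := boolP (i \in S).
  by rewrite (bigD1 i) //= eqxx big1 ?addn0 // => t /andP[_ /negbTE->].
by rewrite big1 // => t tS; case: eqP tS iS => // -> ->.
Qed.

(** The number [n] is fuel: the recursive calls pass through [dsum] to pairs smaller for [wmu],
    which is not a structural recursion. Any variable of exponent at least 2 may serve for the
    contraction. *)
Fixpoint phin n a S w : K :=
  if n is n'.+1 then
    match w with
    | [::] => ext S (lcyc a)
    | _ => if [pick i | (1 < (mesym1 S + wbeta w + mesym1 (lset a))%MM i)%N]
             is Some i then - sigma P i (dsum y (phin n') S w (phin n' a)) else 0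
    end
  else 0.

Lemma phin_cons n a S b w : phin n.+1 a S (b :: w) =
  if [pick i | (1 < (mesym1 S + wbeta (b :: w) + mesym1 (lset a))%MM i)%N]
    is Some i then - sigma P i (dsum y (phin n) S (b :: w) (phin n a)) else 0.
Proof. by []. Qed.

Lemma phin_eq n n' a S w :
  (wmu S w < n)%N -> (wmu S w < n')%N -> phin n a S w = phin n' a S w.
Proof.
have [N] := ubnP (wmu S w); elim: N => // N IH in n n' a S w *.
rewrite ltnS => ltN ltn ltn'.
case: n ltn => [|n] ltn; first by rewrite ltn0 in ltn.
case: n' ltn' => [|n'] ltn' /=; first by rewrite ltn0 in ltn'.
case: w ltn ltn' ltN => // b w ltn ltn' ltN.
case: pickP => // i _; congr (- sigma _ _ _).
have lt T v : (wmu T v < wmu S (b :: w))%N ->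
    forall c, phin n c T v = phin n' c T v.
  by move=> vw c; apply: IH; apply: leq_trans vw _.
rewrite (@eq_dsum_phi _ _ _ _ _ (phin n')) => [|c v /lt -> //].
by apply: eq_dsum => T v /lt.
Qed.

(* [phi a S w], the component of d(e_S (x) (w a)) in the Koszul complex, is
   up to sign the product of [e_S] with a Massey operation on [w a]; in a
   squarefree multidegree it vanishes unless [w] is empty, and the Koszul
   complex is contractible in the other multidegrees. *)
Definition phi a S w : K := phin (wmu S w).+1 a S w.

Lemma phin_stable n a S w : (wmu S w < n)%N -> phin n a S w = phi a S w.
Proof.
by move=> ltn; rewrite /phi; apply: phin_eq.
Qed.

Lemma phi_nil a S : phi a S [::] = ext S (lcyc a).
Proof. by []. Qed.

Lemma phi_cons a S b w : phi a S (b :: w) =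
  if [pick i | (1 < (mesym1 S + wbeta (b :: w) + mesym1 (lset a))%MM i)%N]
    is Some i then - sigma P i (dsum y phi S (b :: w) (phi a)) else 0.
Proof.
rewrite {1}/phi phin_cons; case: pickP => // i _; congr (- sigma _ _ _).
rewrite (@eq_dsum_phi _ _ _ _ _ phi) => [|c v vw]; last exact: phin_stable.
by apply: eq_dsum => T v vw; apply: phin_stable.
Qed.

Definition gphi b S v :=
  graded (mesym1 S + wbeta v + mesym1 (lset b))%MM (#|S| + wdeg v + ldeg b)
    (phi b S v).

(** The shifts [nu] and [j] absorb the letters already peeled off: the induction on [w] moves its
    head into them. *)
Lemma dsum_graded S w (G : {set 'I_r} -> seq letter -> K) nu j e :
  (forall b v, (wmu S v < wmu S w)%N -> gphi b S v) ->
  (forall T v, (wmu T v < wmu S w)%N ->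
    graded (mesym1 T + wbeta v + nu)%MM (#|T| + wdeg v + j) (G T v)) ->
  (e.+1 = #|S| + wdeg w + j)%N ->
  graded (mesym1 S + wbeta w + nu)%MM e (dsum y phi S w G).
Proof.
elim: w G nu j => [|a w IH] G nu j Hphi HG ej /=.
  rewrite sum_kbas; apply: graded_sum => s sS.
  have eS : #|S| = #|S :\ s|.+1 by rewrite (cardsD1 s) sS.
  apply: (gradedZ (be := (mesym1 (S :\ s) + wbeta ([::] : seq letter) + nu)%MM)) => [m|].
    rewrite (cf_sign P) (cf_y P) mulf_eq0 signr_eq0 /= natb_neq0 => /eqP->.
    by rewrite -{2}(setD1K sS) mesym1U1 ?inE ?eqxx // !addmA.
  have := HG (S :\ s) [::]; rewrite (_ : e = #|S :\ s| + wdeg ([::] : seq letter) + j)%N.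
    by apply; rewrite /wmu eS /=; lia.
  by move: ej; rewrite eS /=; lia.
apply: gradedD; last first.
  have -> : (mesym1 S + (mesym1 (lset a) + wbeta w) + nu =
      mesym1 S + wbeta w + (mesym1 (lset a) + nu))%MM.
    by apply/mnmP=> t; rewrite !mnmDE; lia.
  apply: (IH _ _ ((ldeg a).+1 + j)%N) => [b v vw|T v vw|].
  - by apply: Hphi; apply: ltn_trans vw _; rewrite wmu_size.
  - have := HG T (a :: v); rewrite wmu_cons => /(_ vw) /=.
    rewrite (_ : (mesym1 T + (mesym1 (lset a) + wbeta v) + nu =
      mesym1 T + wbeta v + (mesym1 (lset a) + nu))%MM); last first.
      by apply/mnmP=> t; rewrite !mnmDE; lia.
    by rewrite (_ : #|T| + ((ldeg a).+1 + wdeg v) + j =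
      #|T| + wdeg v + ((ldeg a).+1 + j))%N; last lia.
  - by move: ej => /=; lia.
have aw : (wmu S w < wmu S (a :: w))%N by rewrite wmu_size.
apply: graded_sum => T _ T' m; rewrite ffunE => /cf_mul[m1 [m2 [->]]].
have a0 : (wmu T ([::] : seq letter) < wmu S (a :: w))%N by apply: wmu_size.
move=> /(Hphi a w aw)[e1 e2] /(HG T [::] a0)[e3 e4]; split.
  apply/mnmP=> t; move/mnmP/(_ t): e1; move/mnmP/(_ t): e3.
  by rewrite /= !mnmDE mnm0E; lia.
by rewrite e4 e2; move: ej => /=; lia.
Qed.

Lemma graded_neq0 al j f T : graded al j f -> f T != 0 -> (mesym1 T <= al)%MM.
Proof.
move=> gf; apply: contraNT => nT; apply/eqP/(@cf_inj _ _ _ _ _ P) => m.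
apply: contraNeq nT => /gf[<- _]; exact: lem_addl.
Qed.

(** The differential is multihomogeneous with coefficients in R, so only pairs of multidegree at
    most that of (S, w) can occur in it. *)
Lemma dsum_eq0 S w (V : lmodType R) (G : {set 'I_r} -> seq letter -> V) :
  (forall b v, (wmu S v < wmu S w)%N -> gphi b S v) ->
  (forall T v, (wmu T v < wmu S w)%N ->
    (mesym1 T + wbeta v <= mesym1 S + wbeta w)%MM -> G T v = 0) ->
  dsum y phi S w G = 0.
Proof.
elim: w G => [|a w IH] G Hphi HG /=.
  rewrite sum_kbas big1 // => s sS; rewrite HG ?scaler0 //.
    by rewrite /wmu (cardsD1 s S) sS /=.
  rewrite !addm0; apply/mnm_lepP => t; rewrite !mesym1E !inE.
  by case: (t == s).
rewrite IH => [|b v vw|T v vw le]; last 2 first.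
- by apply: Hphi; apply: ltn_trans vw _; rewrite wmu_size.
- apply: HG; rewrite ?wmu_cons //; move/mnm_lepP: le => le.
  by apply/mnm_lepP => t; have := le t; rewrite /= !mnmDE; lia.
rewrite addr0 big1 // => T _; have [->|nT] := eqVneq (phi a S w T) 0.
  by rewrite scale0r.
rewrite HG ?scaler0 ?wmu_size //.
have aw : (wmu S w < wmu S (a :: w))%N by rewrite wmu_size.
have := graded_neq0 (Hphi a w aw) nT.
move/mnm_lepP=> le; apply/mnm_lepP=> t; have := le t.
by rewrite /= !mnmDE mnm0E; lia.
Qed.

Hypothesis golodD : golod_complex face.

(** Both claims must be proved together: the relation for smaller pairs makes the obstruction [kap]
    a cycle, and the grading makes the contraction the identity on it. *)
Lemma phi_spec a S w : gphi a S w /\ d (phi a S w) = - dsum y phi S w (phi a).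
Proof.
have [N] := ubnP (wmu S w); elim: N => // N IH in a S w *; rewrite ltnS => ltN.
case: w ltN => [|b w] ltN.
  split; last by rewrite phi_nil d_ext ?lcyc_cycle.
  rewrite /gphi /= addm0 addn0 phi_nil; apply: ext_graded => T m cm.
  split; first exact: lcyc_hom cm.
  apply/eqP; apply: contraNT cm => Tj; rewrite lcyc_deg // (cf0 P) //.
set al := (mesym1 S + wbeta (b :: w) + mesym1 (lset a))%MM.
have IHw T v c : (wmu T v < wmu S (b :: w))%N ->
    gphi c T v /\ d (phi c T v) = - dsum y phi T v (phi c).
  by move=> vw; apply: IH; apply: leq_trans vw ltN.
have [e ej] : exists e, (e.+1 = #|S| + wdeg (b :: w) + ldeg a)%N.
  by exists (#|S| + wdeg (b :: w) + ldeg a).-1; rewrite /ldeg; lia.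
have gkap : graded al e (dsum y phi S (b :: w) (phi a)).
  apply: dsum_graded ej => [c v vw|T v vw]; first by have [] := IHw S v c vw.
  by have [] := IHw T v a vw.
rewrite /gphi phi_cons -/al; case: pickP => [i ali|sqf].
  set kap := dsum _ _ _ _ _ in gkap *.
  have dkap : d kap = 0.
    have -> : d kap = dsum y phi S (b :: w) (fun T v => d (phi a T v)).
      exact: (dsum_morph y phi (koszul_diff y : {linear K -> K})).
    rewrite (@eq_dsum _ _ _ _ _ _ _ _ _
      (fun T v => - dsum y phi T v (phi a))) => [|T v vw]; last first.
      by have [] := IHw T v a vw.
    rewrite dsumN dsum_dsum ?oppr0 // => c v vw.
    by have [] := IHw S v c vw.
  (* All of [kap] has multidegree [al], whose exponent at i is at least 2, so the homotopy keeps
     every term. *)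
  have kapE : d (sigma P i kap) = kap.
    apply/ffunP=> T; have -> : d (sigma P i kap) T =
      d (sigma P i kap) T + sigma P i (d kap) T.
      by rewrite dkap (sigma0 P) [(0 : K) T]ffunE addr0.
    apply: (cf_eq (P := P)) => m; rewrite cf_homotopy; case: ifP => // lt2.
    apply/esym/eqP; apply: contraFT lt2 => /gkap[eal _].
    by move: ali; rewrite -eal mnmDE mesym1E.
  split; last by rewrite kdN kapE.
  apply: gradedN => T m; rewrite ffunE; case: ifP => [iT|]; last first.
    by rewrite (cf0 P) eqxx.
  rewrite (cf_sign P) mulf_eq0 signr_eq0 /= cf_quo; case: ifP; last by rewrite eqxx.
  move=> _ /gkap[eal eT]; split; last by rewrite (cardsD1 i) iT eT -ej.
  by rewrite -eal -{1}(setD1K iT) mesym1U1 ?inE ?eqxx // addmA.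
split; first exact: graded0.
(* In a squarefree multidegree [phi] is 0 by definition on nonempty words, so the obstruction itself
   has to vanish. Only the product of [phi b] and [phi a] on empty words is left, and there the
   supports of [a] and [b] are disjoint. *)
have sq t : (al t <= 1)%N by rewrite leqNgt sqf.
rewrite kd0; apply/esym/eqP; rewrite oppr_eq0; apply/eqP.
rewrite /= (@dsum_eq0 S w) => [|c v vw|T v vw le]; last 2 first.
- have bw : (wmu S w < wmu S (b :: w))%N by rewrite wmu_size.
  by have [] := IHw S v c (ltn_trans vw bw).
- rewrite phi_cons; case: pickP => // i; move/mnm_lepP/(_ i): le.
  by have := sq i; rewrite /al /= !mnmDE; lia.
rewrite addr0 big1 // => T _; subst al; clear ej gkap.
case: w ltN IHw sqf sq => [|b' w] ltN IHw sqf sq; last first.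
  rewrite phi_cons; case: pickP => [i|_]; last by rewrite ffunE scale0r.
  by have := sq i; rewrite /= !mnmDE; lia.
apply/ffunP=> T'; rewrite ffunE [RHS]ffunE; apply: ext_annih => T1.
rewrite mulrC; apply: ext_annih => T2; rewrite lcyc_mul0 //.
apply/pred0P => t; apply/negP => /andP[/= ta tb]; have := sq t.
by rewrite /= !mnmDE !mesym1E ta tb; lia.
Qed.

End MasseyOperations.

Import GRing.Theory.


(** * A finite basis of the resolution in each degree *)

Section Basis.
Variables (k : fieldType) (r : nat) (face : pred {set 'I_r}).
Local Notation letter := (letter k face).
Local Notation pt := ({set 'I_r} * seq letter)%type.
Implicit Types (S T : {set 'I_r}) (a b : letter) (v w : seq letter) (p q : pt).

Definition pdeg p : nat := (#|p.1| + wdeg p.2)%N.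

(** Again [n] is fuel, and N is enough since every letter uses up at least one degree. The condition
    ldeg a < N keeps the subtraction from being truncated. *)
Fixpoint basf (n N : nat) : seq pt :=
  [seq (U, [::]) | U <- enum [pred U : {set 'I_r} | #|U| == N]] ++
  if n is n'.+1 then
    flatten [seq [seq (p.1, a :: p.2) | p <- basf n' (N - (ldeg a).+1)%N]
            | a <- enum [pred a : letter | (ldeg a < N)%N]]
  else [::].
Definition bas N := basf N N.

Lemma basE N : bas N =
  [seq (U, [::]) | U <- enum [pred U : {set 'I_r} | #|U| == N]] ++
  flatten [seq [seq (p.1, a :: p.2) | p <- bas (N - (ldeg a).+1)%N]
          | a <- enum [pred a : letter | (ldeg a < N)%N]].
Proof.
have e0 : enum [pred a : letter | (ldeg a < 0)%N] = [::].
  apply/eqP; rewrite -size_eq0 -cardE; apply/eqP/eq_card0 => a.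
  by rewrite !inE ltn0.
have basfE n M : (M <= n)%N -> basf n M = bas M.
  rewrite /bas; elim: n {-2}n (leqnn n) M => [|n0 IH] n nn0 M Mn.
    by have -> : M = n by lia.
  case: n nn0 Mn => [|n] nn0 Mn; first by have -> : M = 0%N by lia.
  case: M Mn => [|M] Mn /=; last first.
    congr (_ ++ flatten _); apply/eq_in_map => a; rewrite mem_enum inE => aM.
    by rewrite !subSS (IH n) ?(IH M) //; lia.
  by rewrite e0.
case: N => [|N]; rewrite {1}/bas /=.
  by rewrite e0.
congr (_ ++ flatten _); apply/eq_in_map => a; rewrite mem_enum inE => aM.
by rewrite subSS basfE //; lia.
Qed.

Lemma big_bas (V : Type) (z : V) (op : Monoid.com_law z) N (F : pt -> V) :
  \big[op/z]_(p <- bas N) F p =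
  op (\big[op/z]_(S : {set 'I_r} | #|S| == N) F (S, [::]))
     (\big[op/z]_(a : letter | (ldeg a < N)%N)
        \big[op/z]_(p <- bas (N - (ldeg a).+1)%N) F (p.1, a :: p.2)).
Proof.
rewrite basE big_cat big_map big_enum /=; congr (op _ _).
rewrite big_flatten big_map big_enum /=; apply: eq_bigr => a _.
by rewrite big_map.
Qed.

Lemma sum_bas (V : nmodType) N (F : pt -> V) :
  \sum_(p <- bas N) F p =
  \sum_(S : {set 'I_r} | #|S| == N) F (S, [::]) +
  \sum_(a : letter | (ldeg a < N)%N)
    \sum_(p <- bas (N - (ldeg a).+1)%N) F (p.1, a :: p.2).
Proof. exact: big_bas. Qed.

Lemma count_bas N p : count_mem p (bas N) = (pdeg p == N).
Proof.
rewrite -sum1_count big_mkcond; case: p => S w.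
elim: w N => [|a w IH] N; rewrite big_bas /pdeg /=.
  rewrite addn0 -big_mkcondr [X in (_ + X)%N]big1 ?addn0 => [|a _]; last first.
    by rewrite big1_seq // => p _; rewrite xpair_eqE andbF.
  have [SN|SN] := boolP (#|S| == N).
    rewrite (big_pred1 S) // => T; rewrite xpair_eqE eqxx andbT /=.
    by case: (T =P S) => [->|]; rewrite ?SN ?andbF.
  rewrite big_pred0 // => T; rewrite xpair_eqE eqxx andbT.
  by case: (T =P S) => [->|]; rewrite ?(negbTE SN) ?andbF.
rewrite [X in (X + _)%N]big1 ?add0n => [|T _]; last by rewrite xpair_eqE andbF.
have E b : b != a ->
    \sum_(p <- bas (N - (ldeg b).+1)%N)
      (if (p.1, b :: p.2) == (S, a :: w) then 1%N else 0%N) = 0%N.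
  move=> ba; rewrite big1_seq // => p _.
  by rewrite xpair_eqE eqseq_cons (negbTE ba) andbF.
have [aN|aN] := boolP (ldeg a < N)%N; last first.
  rewrite big1 => [|b bN]; last by apply: E; apply: contraNneq aN => <-.
  case: eqP => // e; case/negP: aN.
  by rewrite -e addSn addnS ltnS addnCA leq_addr.
rewrite (bigD1 a) //= [X in (_ + X)%N]big1 ?addn0 => [|b /andP[_ /E] //].
have := IH (N - (ldeg a).+1)%N; rewrite /pdeg /= => IHa.
transitivity (nat_of_bool (#|S| + wdeg w == N - (ldeg a).+1)%N); last first.
  congr nat_of_bool; move: (ldeg a) #|S| (wdeg w) aN; clear => ? ? ? ?.
  by apply/eqP/eqP; lia.
rewrite -IHa; apply: eq_bigr => -[T v] _ /=.
by rewrite !xpair_eqE eqseq_cons eqxx.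
Qed.

Lemma mem_bas N p : (p \in bas N) = (pdeg p == N).
Proof. by rewrite -has_pred1 has_count count_bas; case: eqP. Qed.

Lemma bas_uniq N : uniq (bas N).
Proof. by apply: count_mem_uniq => p; rewrite count_bas mem_bas. Qed.
End Basis.

(** * Exactness and minimality *)

Import GRing.Theory.


Section Resolution.
Variables (k : fieldType) (R : comNzRingType) (r : nat).
Variables (iota : k -> R) (y : 'I_r -> R) (P : stanley_reisner iota y).
Local Notation face := (face P).
Local Notation cf := (cf P).
Local Notation K := (koszul R r).
Local Notation d := (koszul_diff y).
Local Notation letter := (letter k face).
Local Notation pt := ({set 'I_r} * seq letter)%type.
Local Notation phi := (phi (P := P)).
Local Notation bas := (@bas k r face).
Local Notation dsum := (dsum y phi).
Implicit Types (S T U : {set 'I_r}) (a b : letter) (v w : seq letter) (p q : pt).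
Implicit Types (f g : pt -> R) (M N : nat).
Hypothesis golodD : golod_complex face.

Definition p0 : pt := (set0, [::]).

Definition dcoef p q : R := dsum p.1 p.2 (fun T v => ((T, v) == q)%:R : R^o).

Lemma dsum_const0 S w (V : lmodType R) : dsum S w (fun _ _ => 0 : V) = 0.
Proof.
elim: w => [|a w IH] /=; rewrite ?IH ?addr0 big1 // => T _; exact: scaler0.
Qed.

Lemma dcoef_nil S T : dcoef (S, [::]) (T, [::]) = d (kbas R S) T.
Proof.
rewrite /dcoef /= (bigD1 T) //= eqxx big1 ?addr0 => [|U nU].
  by rewrite /GRing.scale /= mulr1.
by rewrite xpair_eqE (negbTE nU) scaler0.
Qed.

Lemma dcoef_nil_cons S T a v : dcoef (S, [::]) (T, a :: v) = 0.
Proof. by rewrite /dcoef /= big1 // => U _; rewrite xpair_eqE andbF scaler0. Qed.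

Lemma dcoef_cons_nil S a w T : dcoef (S, a :: w) (T, [::]) = phi a S w T.
Proof.
rewrite /dcoef /= (bigD1 T) //= eqxx big1 => [|U nU]; last first.
  by rewrite xpair_eqE (negbTE nU) scaler0.
rewrite (@eq_dsum _ _ _ _ _ _ _ _ _ (fun _ _ => 0)) => [|U u _]; last first.
  by rewrite xpair_eqE andbF.
by rewrite dsum_const0 !addr0 /GRing.scale /= mulr1.
Qed.

Lemma dcoef_cons S a w T b v :
  dcoef (S, a :: w) (T, b :: v) = if a == b then dcoef (S, w) (T, v) else 0.
Proof.
rewrite /dcoef /= big1 => [|U _]; last by rewrite xpair_eqE andbF scaler0.
rewrite add0r; case: eqP => [->|ab].
  apply: (@eq_dsum R r y letter phi R^o) => U u _.
  by rewrite !xpair_eqE eqseq_cons eqxx.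
rewrite (@eq_dsum _ _ _ _ _ _ _ _ _ (fun _ _ => 0)) ?dsum_const0 // => U u _.
by rewrite xpair_eqE eqseq_cons (introF eqP ab) andbF.
Qed.

Lemma phi_deg a S w : koszul_deg (#|S| + wdeg w + ldeg a) (phi a S w).
Proof. by have [/graded_deg] := phi_spec golodD a S w. Qed.

Lemma dcoef_deg p q : pdeg p != (pdeg q).+1 -> dcoef p q = 0.
Proof.
case: p => S w; case: q => T v; rewrite /pdeg /=.
elim: w v => [|a w IH] [|b v] /=.
- rewrite dcoef_nil !addn0 => ST; apply/eqP; apply: contraNT ST.
  by case/kbas_neq0 => s sS [-> _]; rewrite (cardsD1 s S) sS.
- by rewrite dcoef_nil_cons.
- rewrite dcoef_cons_nil addn0 => ST; apply: phi_deg; apply: contraNneq ST => ->.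
  by apply/eqP; move: #|S| => n; lia.
- rewrite dcoef_cons; case: (a =P b) => // -> H; apply: IH; apply: contraNneq H.
  by move: #|S| #|T| => n n' e; apply/eqP; lia.
Qed.

Lemma dsumE N p (V : lmodType R) (G : {set 'I_r} -> seq letter -> V) :
  pdeg p = N.+1 ->
  dsum p.1 p.2 G = \sum_(q <- bas N) dcoef p q *: G q.1 q.2.
Proof.
move=> pN; case: p pN => S w; rewrite /pdeg /=.
elim: w N G => [|a w IH] N G pN; rewrite sum_bas /=.
  rewrite [X in _ + X]big1 ?addr0 => [|a _]; last first.
    by rewrite big1 // => q _; rewrite dcoef_nil_cons scale0r.
  rewrite (bigID (fun T : {set 'I_r} => #|T| == N)) /= [X in _ + X]big1 ?addr0.
    by apply: eq_bigr => T _; rewrite dcoef_nil.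
  move=> T TN; have [->|/kbas_neq0[s sS [TS _]]] := eqVneq (d (kbas R S) T) 0.
    by rewrite scale0r.
  by case/eqP: TN; move: pN; rewrite TS addn0 (cardsD1 s S) sS => -[].
have eN : N = (#|S| + wdeg w + ldeg a)%N.
  by move: pN; rewrite addnCA addSn => -[<-]; rewrite addnC.
congr (_ + _).
  rewrite (bigID (fun T : {set 'I_r} => #|T| == N)) /= [X in _ + X]big1 ?addr0.
    by apply: eq_bigr => T _; rewrite dcoef_cons_nil.
  by move=> T TN; rewrite phi_deg -?eN // scale0r.
have [aN|aN] := boolP (ldeg a < N)%N; last first.
  rewrite big1 => [|b bN]; last first.
    apply: big1 => q _; rewrite dcoef_cons; case: eqP => [e|]; rewrite ?scale0r //.
    by move: aN; rewrite e bN.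
  (* Here ldeg a = N, so (S, w) is the generator of degree 0 and its differential is zero; the basis
     of degree N has no pair ending in [a]. *)
  have w0 : #|S| = 0%N /\ wdeg w = 0%N.
    by move: eN aN; clear; move: #|S| (wdeg w) (ldeg a) => ? ? ?; split; lia.
  case: w w0 {IH pN eN} => [|b w] [S0 //] _ /=; rewrite sum_kbas big1 // => s.
  by rewrite (cards0_eq S0) inE.
rewrite (bigD1 a) //= [X in _ + X]big1 ?addr0 => [|b /andP[_ ba]]; last first.
  by apply: big1 => q _; rewrite dcoef_cons eq_sym (negbTE ba) scale0r.
rewrite (IH (N - (ldeg a).+1)%N); last first.
  by move: eN aN; clear; move: #|S| (wdeg w) (ldeg a) => ? ? ?; lia.
by apply: eq_bigr => -[T v] _ /=; rewrite dcoef_cons eqxx.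
Qed.

Definition bdry N f q : R := \sum_(p <- bas N) f p * dcoef p q.
Definition fdeg N f := forall p, pdeg p != N -> f p = 0.

Lemma bdry_deg N f : fdeg N (bdry N.+1 f).
Proof.
move=> q qN; rewrite /bdry big1_seq // => p /andP[_]; rewrite mem_bas => /eqP pN.
by rewrite dcoef_deg ?mulr0 // pN eqSS eq_sym.
Qed.

Lemma bdry_bdry N f q : bdry N.+1 (bdry N.+2 f) q = 0.
Proof.
rewrite /bdry; under eq_bigr do rewrite mulr_suml.
rewrite exchange_big big1_seq //= => p; rewrite mem_bas => /eqP pN.
transitivity (f p * \sum_(q0 <- bas N.+1) dcoef p q0 *: (dcoef q0 q : R^o)).
  by rewrite mulr_sumr; apply: eq_bigr => q' _; rewrite mulrA.
rewrite -(@dsumE N.+1 p R^o (fun T v => dcoef (T, v) q)) //=.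
  by rewrite dsum_dsum ?mulr0 // => b v _; have [] := phi_spec golodD b p.1 v.
Qed.

(** Modulo the pairs with empty word, the chains ending in [a] form a shifted copy of the whole
    complex; this is the filtration behind [exact_step]. *)
Lemma bdry_cons N f T a v : bdry N f (T, a :: v) =
  if (ldeg a < N)%N then
    bdry (N - (ldeg a).+1) (fun p => f (p.1, a :: p.2)) (T, v) else 0.
Proof.
rewrite {1}/bdry sum_bas big1 ?add0r => [|S _]; last by rewrite dcoef_nil_cons mulr0.
have E b : b != a -> \sum_(p <- bas (N - (ldeg b).+1)%N)
    f (p.1, b :: p.2) * dcoef (p.1, b :: p.2) (T, a :: v) = 0.
  by move=> ba; apply: big1 => p _; rewrite dcoef_cons (negbTE ba) mulr0.
case: ifPn => aN; last first.
  by rewrite big1 // => b bN; apply: E; apply: contraNneq aN => <-.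
rewrite (bigD1 a) //= [X in _ + X]big1 ?addr0 => [|b /andP[_ /E] //].
by apply: eq_bigr => -[S w] _; rewrite dcoef_cons eqxx.
Qed.

(** The component of the boundary from chains ending in [a] to the Koszul complex. By [Phi_bdry] it
    anticommutes with the differentials, and on the generator of degree 0 it gives the cycle
    [lcyc a]. *)
Definition Phi a N f : K := \sum_(p <- bas N) f p *: phi a p.1 p.2.

Lemma bdry_nil N f T : fdeg N f -> bdry N f (T, [::]) =
  d [ffun S => f (S, [::])] T +
  (\sum_(a | (ldeg a < N)%N)
    Phi a (N - (ldeg a).+1) (fun p => f (p.1, a :: p.2))) T.
Proof.
move=> fN; rewrite {1}/bdry sum_bas; congr (_ + _).
  rewrite [X in d X]kbas_expand kd_sum sum_ffunE.
  rewrite [RHS](bigID (fun S : {set 'I_r} => #|S| == N)) /=.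
  rewrite [X in _ = _ + X]big1 ?addr0 => [|S SN]; last first.
    by rewrite [X in X *: _]ffunE fN /pdeg /= ?addn0 // scale0r kd0 ffunE.
  apply: eq_bigr => S _; rewrite dcoef_nil kdZ.
  by rewrite [RHS]ffunE [X in X *: _]ffunE.
rewrite sum_ffunE; apply: eq_bigr => a _; rewrite sum_ffunE.
by apply: eq_bigr => p _; rewrite dcoef_cons_nil ffunE.
Qed.

Lemma Phi_deg a N f : koszul_deg (N + ldeg a) (Phi a N f).
Proof.
move=> S SN; rewrite sum_ffunE big1_seq // => p /andP[_]; rewrite mem_bas => /eqP pN.
by rewrite ffunE phi_deg ?scaler0 // -[(_ + wdeg _)%N]/(pdeg p) pN.
Qed.

Lemma Phi_bdry a N f : Phi a N (bdry N.+1 f) = - d (Phi a N.+1 f).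
Proof.
rewrite /Phi /bdry kd_sum -sumrN; under eq_bigr do rewrite scaler_suml.
rewrite exchange_big; apply: eq_big_seq => p; rewrite mem_bas => /eqP pN.
rewrite kdZ (phi_spec golodD a p.1 p.2).2 scalerN opprK (@dsumE N) //.
by rewrite scaler_sumr; apply: eq_bigr => q _; rewrite scalerA.
Qed.

Lemma Phi_p0 a (c : R) : Phi a 0 (fun p => (p == p0)%:R * c) = c *: lcyc a.
Proof.
rewrite /Phi sum_bas [X in _ + X]big_pred0 // addr0.
rewrite (big_pred1 set0) => [|S]; last by rewrite cards_eq0.
rewrite eqxx mul1r /= phi_nil /ext; congr (_ *: _).
by elim: (enum 'I_r) => //= i l ->; rewrite inE.
Qed.

Lemma eq_bdry N f g q : f =1 g -> bdry N f q = bdry N g q.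
Proof. by move=> fg; apply: eq_bigr => p _; rewrite fg. Qed.

Lemma eq_Phi a N f g : f =1 g -> Phi a N f = Phi a N g.
Proof. by move=> fg; apply: eq_bigr => p _; rewrite fg. Qed.

Lemma Phi0 a N f : (forall p, f p = 0) -> Phi a N f = 0.
Proof. by move=> f0; apply: big1 => p _; rewrite f0 scale0r. Qed.

Lemma PhiD a N f g : Phi a N (fun p => f p + g p) = Phi a N f + Phi a N g.
Proof. by rewrite -big_split; apply: eq_bigr => p _; rewrite scalerDl. Qed.

(** The scalar [c] accounts for H_0 = k and is allowed to be nonzero in degree 0 only. *)
Definition exact_at N f := exists c : k, exists g,
  [/\ (0 < N)%N -> c = 0, fdeg N.+1 g
    & forall q, f q = bdry N.+1 g q + (q == p0)%:R * iota c].

Lemma exact_at0 f : fdeg 0 f -> exact_at 0 f.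
Proof.
move=> fN; pose x := f p0; exists (cf x 0%MM).
have [h hE] : exists h, x - iota (cf x 0%MM) = \sum_i h i * y i.
  by apply: (cf_aug (s0 := P)); rewrite (cfB P) (cf_iota P) eqxx mulr1 subrr.
exists (fun p => if p.2 is [::] then \sum_i h i * (p.1 == [set i])%:R else 0).
split=> // [[S [|a w]] //= pN|[T [|a v]]].
- apply: big1 => i _; case: eqP => [e|]; rewrite ?mulr0 //.
  by move: pN; rewrite /pdeg /= e cards1.
- rewrite bdry_nil => [|[S [|a w]] //= pN]; last first.
    apply: big1 => i _; case: eqP => [e|]; rewrite ?mulr0 //.
    by move: pN; rewrite /pdeg /= e cards1.
  rewrite sum_ffunE [X in _ + X + _]big_pred0 // addr0.
  set g := finfun _; have -> : g = \sum_i h i *: kbas R [set i].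
    apply/ffunP=> S; rewrite sum_ffunE ffunE; apply: eq_bigr => i _.
    by rewrite 2!ffunE.
  rewrite kd_sum sum_ffunE.
  under eq_bigr do rewrite kdZ ffunE d_kbas1 /GRing.scale /= mulrCA.
  rewrite -mulr_sumr -hE.
  rewrite xpair_eqE andbT; have [->|nT] := eqVneq T set0.
    by rewrite !mul1r subrK.
  by rewrite !mul0r addr0 fN // /pdeg /= addn0 cards_eq0.
- by rewrite bdry_cons add0r xpair_eqE andbF mul0r fN // /pdeg /= addnS.
Qed.

(** For each last letter a the part [fa a] is a cycle of smaller degree, hence a boundary up to a
    scalar. Correcting f by these boundaries leaves a Koszul chain [kap'] whose boundary is a
    combination of the cycles of the letters. Their independence in homology kills the scalars, and
    their spanning property then fills in [kap']. *)
Lemma exact_step N f : fdeg N f -> (forall q, bdry N f q = 0) -> exact_at N f.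
Proof.
elim: N {-2}N (leqnn N) f => [|n IH] N Nn f fN f0.
  by move: Nn fN; rewrite leqn0 => /eqP -> /exact_at0.
case: (posnP N) fN => [-> /exact_at0 //|N0 fN].
pose M a := (N - (ldeg a).+1)%N; pose fa a p := f (p.1, a :: p.2).
have fa_deg a : (ldeg a < N)%N -> fdeg (M a) (fa a).
  move=> aN p pM; apply: fN; apply: contraNneq pM.
  by rewrite /pdeg /= /M; move: #|p.1| => m e; apply/eqP; lia.
have fa_cyc a : (ldeg a < N)%N -> forall q, bdry (M a) (fa a) q = 0.
  by move=> aN [T v]; have := f0 (T, a :: v); rewrite bdry_cons aN.
have cg_ex a : exists cg : k * (pt -> R), (ldeg a < N)%N ->
    [/\ (0 < M a)%N -> cg.1 = 0, fdeg (M a).+1 cg.2 & forall q,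
    fa a q = bdry (M a).+1 cg.2 q + (q == p0)%:R * iota cg.1].
  have [|] := boolP (ldeg a < N)%N; last by exists (0, fun=> 0).
  move=> aN; have [|c [g H]] := IH (M a) _ (fa a) (fa_deg a aN) (fa_cyc a aN).
    by rewrite /M; lia.
  by exists (c, g).
have [cg cgP] := fin_all_exists cg_ex.
pose PN : pred letter := fun a => (ldeg a < N)%N.
have Phi_fa a : PN a -> Phi a (M a) (fa a) =
    - d (Phi a (M a).+1 (cg a).2) + iota (cg a).1 *: lcyc a.
  move=> aN; have [c0 _ E] := cgP a aN; rewrite (eq_Phi _ _ E) PhiD Phi_bdry.
  congr (_ + _); case: (posnP (M a)) => [->|/c0 ->]; first exact: Phi_p0.
  by rewrite (iota0 P) scale0r; apply: Phi0 => p; rewrite mulr0.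
pose kap : K := [ffun S => f (S, [::])].
pose kap' := kap - \sum_(a | PN a) Phi a (M a).+1 (cg a).2.
have Ma a : PN a -> ((M a).+1 + ldeg a = N)%N by rewrite /PN /M; lia.
have kap'_deg : koszul_deg N kap'.
  move=> S SN; rewrite koszulB sum_ffunE big1 => [|a aN]; last first.
    by apply: (@Phi_deg a (M a).+1); rewrite Ma.
  by rewrite subr0 ffunE fN // /pdeg /= addn0.
have dkap' : d kap' + \sum_(a | PN a) iota (cg a).1 *: lcyc a = 0.
  apply/ffunP=> T; rewrite [RHS]ffunE -[RHS](f0 (T, [::])) bdry_nil //.
  rewrite (eq_bigr _ Phi_fa) big_split /= sumrN -kd_sum.
  rewrite [LHS]ffunE /kap' kdB -/kap.
  by rewrite [X in X + _ = _]ffunE [X in _ = _ + X]ffunE addrA.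
(* A scalar can be nonzero only when [fa a] has degree 0, that is for ldeg a = N - 1, so the
   relation [dkap'] is homogeneous and [lcyc_indep] applies to it. *)
have c0 a : PN a -> (cg a).1 = 0.
  move=> aN; case: (posnP (M a)) => [Ma0|]; last by case: (cgP a aN).
  have aN1 : ldeg a = N.-1 by have := Ma a aN; rewrite Ma0; lia.
  apply: (@lcyc_indep _ _ _ _ _ P N.-1 (fun a => (cg a).1)) aN1.
  exists (- kap'); split.
    by move=> S; rewrite prednK // => SN; rewrite ffunE kap'_deg ?oppr0.
  rewrite kdN; apply/eqP; rewrite -subr_eq0 opprK addrC -{2}dkap'; apply/eqP.
  congr (_ + _); rewrite [RHS](bigID (fun b => ldeg b == N.-1)) /=.
  rewrite [X in _ = _ + X]big1 ?addr0 => [|b /andP[bN nb]].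
    apply: eq_bigl => b; rewrite /PN; case: eqP => [->|]; rewrite ?andbF //.
    by rewrite andbT; lia.
  have [H _ _] := cgP b bN; rewrite H ?(iota0 P) ?scale0r // /M.
  by move: bN nb; rewrite /PN; move: (ldeg b) => m; lia.
have kap'_cyc : d kap' = 0.
  by move: dkap'; rewrite big1 ?addr0 // => a /c0 ->; rewrite (iota0 P) scale0r.
have [e [lam [lam_deg lamE]]] :=
  @lcyc_span _ _ _ _ _ P N kap' N0 (conj kap'_deg kap'_cyc).
(* A letter with ldeg a = N enters only through the pair (set0, [:: a]), of degree N + 1, whose
   differential is [lcyc a]. *)
pose g (p : pt) : R := match p.2 with
  | [::] => lam p.1
  | a :: w => if (ldeg a < N)%N then (cg a).2 (p.1, w) else
              if ldeg a == N then ((p.1, w) == p0)%:R * iota (e a) else 0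
  end.
have gN : fdeg N.+1 g.
  case=> S [|a w] pN; rewrite /g /=.
    by apply: lam_deg; move: pN; rewrite /pdeg /= addn0.
  move: pN; rewrite /pdeg /=; case: ifPn => aN pN.
    have [_ H _] := cgP a aN; apply: H; apply: contraNneq pN; rewrite /pdeg /=.
    by move: (Ma a aN) #|S| => <- m; move: (M a) (ldeg a) => ? ? ?; apply/eqP; lia.
  case: eqP => // aN'; case: eqP => [[S0 w0]|]; rewrite ?mul0r //.
  by move: pN; rewrite S0 w0 cards0 /= aN' addn0 eqxx.
exists 0, g; split => // -[T [|a v]]; rewrite (iota0 P) mulr0 addr0.
- rewrite bdry_nil //; have -> : [ffun S => g (S, [::])] = lam.
    by apply/ffunP=> S; rewrite ffunE.
  rewrite -lamE -[f _]/(f (T, [::])).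
  have -> : f (T, [::]) = kap T by rewrite ffunE.
  have -> : kap = kap' + \sum_(a | PN a) Phi a (M a).+1 (cg a).2.
    by rewrite subrK.
  rewrite [\sum_(a | (ldeg a < N.+1)%N) _](bigID PN) /=.
  have -> : \sum_(a | (ldeg a < N.+1)%N && PN a)
      Phi a (N.+1 - (ldeg a).+1) (fun p => g (p.1, a :: p.2)) =
      \sum_(a | PN a) Phi a (M a).+1 (cg a).2.
    apply: eq_big => [a|a /andP[_ aN]].
      by rewrite /PN; case: (ltnP (ldeg a) N) => H; rewrite ?andbF // ltnW.
    have -> : (N.+1 - (ldeg a).+1 = (M a).+1)%N by have := Ma a aN; lia.
    by apply: eq_Phi => -[S w]; rewrite /g /= -/(PN a) aN.
  have -> : \sum_(a | (ldeg a < N.+1)%N && ~~ PN a)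
      Phi a (N.+1 - (ldeg a).+1) (fun p => g (p.1, a :: p.2)) =
      \sum_(a | ldeg a == N) iota (e a) *: lcyc a.
    apply: eq_big => [a|a /andP[aN nP]].
      by rewrite /PN ltnS -leqNgt andbC eqn_leq andbC.
    have eN : ldeg a = N by move: aN nP; rewrite /PN; lia.
    rewrite -Phi_p0 eN subnn; apply: eq_Phi => -[S w].
    by rewrite /g /= eN ltnn eqxx.
  set A := \sum_(a | PN a) _; set B := \sum_(a | ldeg a == N) _.
  by rewrite koszulB !koszulD [A T + _]addrC addrA subrK.
- rewrite bdry_cons ltnS; have [aN|aN] := boolP (ldeg a <= N)%N; last first.
    by apply: fN; move: aN; rewrite /pdeg /=; move: #|T| (ldeg a) => m l; lia.
  rewrite subSS; case: (ltngtP (ldeg a) N) aN => // aN _.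
    have [_ _ E] := cgP a aN; rewrite -[LHS]/(fa a (T, v)) E c0 // (iota0 P) mulr0.
    rewrite addr0 -(Ma a aN) addnK; apply: eq_bdry => -[S w].
    by rewrite /g /= aN.
  rewrite aN subnn; rewrite /bdry sum_bas [X in _ + X]big_pred0 // addr0.
  rewrite (big_pred1 set0) => [|S]; last by rewrite cards_eq0.
  rewrite (dcoef_deg (q := (T, v))) ?mulr0; last first.
    by rewrite /pdeg /= cards0.
  by apply: fN; rewrite /pdeg /= aN; move: #|T| => m; lia.
Qed.
End Resolution.

Import GRing.Theory.


Section Minimal.
Variables (k : fieldType) (R : comNzRingType) (r : nat).
Variables (iota : k -> R) (y : 'I_r -> R) (P : stanley_reisner iota y).
Local Notation face := (face P).
Local Notation cf := (cf P).
Local Notation letter := (letter k face).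
Local Notation pt := ({set 'I_r} * seq letter)%type.
Local Notation phi := (phi (P := P)).
Local Notation bas := (@bas k r face).
Local Notation dcoef := (dcoef (P := P)).
Local Notation bdry := (bdry (P := P)).
Local Notation fdeg := (@fdeg k R r iota y P).
Local Notation p0 := (p0 P).
Implicit Types (S T U : {set 'I_r}) (a b : letter) (v w : seq letter) (p q : pt).
Implicit Types (M N : nat).
Hypothesis golodD : golod_complex face.
Variable eps : R -> k.
Hypothesis epsE : forall x, eps x = cf x 0%MM.

Lemma mdeg_wbeta w : (wdeg w <= mdeg (wbeta w))%N.
Proof.
elim: w => [|a w IH] /=; first by rewrite mdeg0.
by rewrite mdegD mdeg_mesym1 leq_add // ldeg_lt.
Qed.

(** Minimality. Koszul coefficients are signed variables or 0. A constant term in [phi a S w] at T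
    would make #|T| equal to the total multidegree, whereas the homological degree is strictly
    smaller by [ldeg_lt]. *)
Lemma eps_dcoef p q : eps (dcoef p q) = 0.
Proof.
rewrite epsE; case: p q => S w [T v]; elim: w v => [|a w IH] [|b v].
- rewrite dcoef_nil.
  have [->|/kbas_neq0[s sS [_ ->]]] := eqVneq (koszul_diff y (kbas R S) T) 0.
    exact: (cf0 P).
  by rewrite (cf_sign P) (cf_y P) eq_sym mnm1_eq0 mulr0.
- by rewrite dcoef_nil_cons (cf0 P).
- rewrite dcoef_cons_nil; apply/eqP/negP => /negP.
  case/(phi_spec golodD a S w).1 => e1 e2.
  move/(congr1 (@mdeg r)): e1; rewrite !mdegD mdeg0 !mdeg_mesym1 e2.
  have := mdeg_wbeta w; have := ldeg_lt a; move: #|lset a| #|S| => m n; lia.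
- by rewrite dcoef_cons; case: ifP => // _; rewrite (cf0 P).
Qed.

Lemma eps_mul x z : eps z = 0 -> eps (x * z) = 0.
Proof.
rewrite !epsE => z0; apply/eqP/negP => /negP/cf_mul[m1 [m2 [e _]]].
have /eqP : (m1 + m2)%MM == 0%MM by rewrite -e.
by move/eqP; rewrite mnmD_eq0 => /andP[_ /eqP->]; rewrite z0 eqxx.
Qed.

Lemma eps_bdry N f q : eps (bdry N f q) = 0.
Proof.
rewrite epsE (cf_sum P) big1 // => p _.
by rewrite -epsE eps_mul // eps_dcoef.
Qed.

Definition bas_nth N (i : nat) : pt := nth p0 (bas N) i.
Definition dmx N : 'M[R]_(size (bas N.+1), size (bas N)) :=
  \matrix_(i, j) dcoef (bas_nth N.+1 i) (bas_nth N j).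
Definition fun_of_row N (u : 'rV[R]_(size (bas N))) p : R :=
  \sum_i u 0 i * (bas_nth N i == p)%:R.
Definition row_of_fun N (f : pt -> R) : 'rV[R]_(size (bas N)) :=
  \row_i f (bas_nth N i).

Lemma pdeg_nth N (i : 'I_(size (bas N))) : pdeg (bas_nth N i) = N.
Proof. by apply/eqP; rewrite -mem_bas mem_nth. Qed.

Lemma fun_of_rowE N (u : 'rV[R]_(size (bas N))) (i : 'I_(size (bas N))) :
  fun_of_row u (bas_nth N i) = u 0 i.
Proof.
rewrite /fun_of_row (bigD1 i) //= eqxx mulr1 big1 ?addr0 // => j ji.
by rewrite nth_uniq ?bas_uniq // (inj_eq val_inj) (negbTE ji) mulr0.
Qed.

Lemma fun_of_row_deg N u : fdeg N (@fun_of_row N u).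
Proof.
move=> p pN; apply: big1 => i _; case: eqP => [e|]; rewrite ?mulr0 //.
by case/eqP: pN; rewrite -e pdeg_nth.
Qed.

Lemma mul_dmx N (u : 'rV[R]_(size (bas N.+1))) (j : 'I_(size (bas N))) :
  (u *m dmx N) 0 j = bdry N.+1 (fun_of_row u) (bas_nth N j).
Proof.
rewrite mxE [RHS](big_nth p0) big_mkord; apply: eq_bigr => i _.
by rewrite mxE fun_of_rowE.
Qed.

Lemma row_of_fun_dmx N f :
  row_of_fun N.+1 f *m dmx N = row_of_fun N (bdry N.+1 f).
Proof.
apply/rowP=> j; rewrite mxE [RHS]mxE [RHS](big_nth p0) big_mkord.
by apply: eq_bigr => i _; rewrite !mxE.
Qed.

Lemma fun_of_row_eq0 N f : fdeg N f -> row_of_fun N f = 0 -> forall q, f q = 0.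
Proof.
move=> fN f0 q; have [qN|/fN //] := eqVneq (pdeg q) N.
have qb : q \in bas N by rewrite mem_bas qN.
have lt : (index q (bas N) < size (bas N))%N by rewrite index_mem.
by have /rowP/(_ (Ordinal lt)) := f0; rewrite !mxE /bas_nth /= nth_index.
Qed.

Lemma row_of_funK N u : row_of_fun N (fun_of_row u) = u.
Proof. by apply/rowP=> i; rewrite mxE fun_of_rowE. Qed.

Lemma exact_dmx N (u : 'rV[R]_(size (bas N.+1))) :
  u *m dmx N = 0 <-> exists v : 'rV[R]_(size (bas N.+2)), u = v *m dmx N.+1.
Proof.
split=> [u0|[v ->]]; last first.
  rewrite -[v]row_of_funK !row_of_fun_dmx.
  by apply/rowP=> i; rewrite !mxE bdry_bdry.
have [q|c [g [c0 gN E]]] := exact_step golodD (@fun_of_row_deg _ u).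
  apply: (@fun_of_row_eq0 N); first exact: bdry_deg.
  by apply/rowP=> j; rewrite mxE -mul_dmx u0.
exists (row_of_fun N.+2 g); rewrite row_of_fun_dmx //; apply/rowP=> i.
by rewrite mxE -fun_of_rowE E c0 // (iota0 P) mulr0 addr0.
Qed.

Lemma bas0 : bas 0 = [:: p0].
Proof.
have p0b : p0 \in bas 0 by rewrite mem_bas /pdeg /= cards0.
apply: perm_small_eq => //; apply: uniq_perm; rewrite ?bas_uniq // => -[S w].
rewrite mem_bas inE /pdeg /= addn_eq0 cards_eq0 xpair_eqE.
by case: w => //= a w; rewrite !andbF.
Qed.

Lemma mem_bas0 p : p \in bas 0 -> p = p0.
Proof. by rewrite bas0 inE => /eqP. Qed.

Definition augmx : 'cV[k]_(size (bas 0)) := const_mx 1.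

Lemma map_augmx (u : 'rV[R]_(size (bas 0))) :
  map_mx eps u *m augmx = (eps (fun_of_row u p0))%:M.
Proof.
apply/rowP=> i; rewrite ord1 !mxE eqxx mulr1n.
have [i0 E] : exists i0 : 'I_(size (bas 0)), forall i : 'I_(size (bas 0)), i = i0.
  have s1 : size (bas 0) = 1%N by rewrite bas0.
  have lt : (0 < size (bas 0))%N by rewrite s1.
  exists (Ordinal lt) => -[j jl]; apply: val_inj; move: jl => /=.
  by rewrite s1; case: j.
rewrite (bigD1 i0) //= big1 ?addr0 => [|j]; last by rewrite (E j) eqxx.
rewrite !mxE mulr1 -fun_of_rowE; congr (eps (fun_of_row _ _)).
have : bas_nth 0 i0 \in bas 0 by rewrite mem_nth.
exact: mem_bas0.
Qed.

Lemma augmx_surj (c : k) : exists u : 'rV[R]_(size (bas 0)),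
  map_mx eps u *m augmx = c%:M.
Proof.
pose f p : R := (p == p0)%:R * iota c; exists (row_of_fun 0 f).
rewrite map_augmx; congr (_%:M).
have p0b : p0 \in bas 0 by rewrite bas0 inE.
have lt : (index p0 (bas 0) < size (bas 0))%N by rewrite index_mem.
have e : p0 = bas_nth 0 (Ordinal lt) by rewrite /bas_nth /= nth_index.
rewrite {1}e fun_of_rowE mxE -e /f eqxx mul1r epsE.
by rewrite (cf_iota P) eqxx mulr1.
Qed.

Lemma exact_augmx (u : 'rV[R]_(size (bas 0))) :
  map_mx eps u *m augmx = 0 <-> exists v : 'rV[R]_(size (bas 1)), u = v *m dmx 0.
Proof.
rewrite map_augmx; split=> [/matrixP/(_ 0 0)|[v ->]].
  rewrite !mxE mulr1n => u0.
  have [q|c [g [_ gN E]]] := exact_step golodD (@fun_of_row_deg _ u).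
    apply: big1_seq => p /andP[_]; rewrite bas0 inE => /eqP->.
    by rewrite dcoef_deg ?mulr0 // /pdeg /= cards0.
  have c0 : c = 0.
    move: u0; rewrite E eqxx mul1r epsE cfD -epsE eps_bdry add0r.
    by rewrite (cf_iota P) eqxx mulr1.
  exists (row_of_fun 1 g); rewrite row_of_fun_dmx //; apply/rowP=> i.
  by rewrite mxE -fun_of_rowE E c0 (iota0 P) mulr0 addr0.
apply/matrixP=> i j; rewrite !ord1 !mxE mulr1n /fun_of_row.
rewrite epsE (cf_sum P) big1 // => l _; rewrite mulrC mul_dmx.
by rewrite -epsE eps_mul // eps_bdry.
Qed.

Definition golod_resolution : free_resolution eps :=
  FreeResolution augmx_surj exact_augmx exact_dmx.

Lemma tor_dim_golod N : tor_dim golod_resolution N = size (bas N).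
Proof.
have dmx0 M : map_mx eps (dmx M) = 0.
  by apply/matrixP=> i j; rewrite !mxE eps_dcoef.
by case: N => [|N] /=; rewrite ?mxrank_ker !dmx0 !mxrank0 !subn0.
Qed.

End Minimal.

(** * The generating series of the ranks *)

Lemma size_bas (k : fieldType) (r : nat) (face : pred {set 'I_r}) N :
  size (@bas k r face N) = ('C(r, N) +
    \sum_(a : letter k face | (ldeg a < N)%N)
      size (@bas k r face (N - (ldeg a).+1)))%N.
Proof.
rewrite -sum1_size big_bas sum1dep_card card_draws card_ord; congr (_ + _)%N.
by apply: eq_bigr => a _; rewrite sum1_size.
Qed.

(** With P the series of the ranks and H that of the letters, each weighted by t^(ldeg + 1),
    [size_bas] reads P = (1 + t)^r + H P in degree N. *)
Lemma golod_series (k : fieldType) (r : nat) (face : pred {set 'I_r})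
    (h : nat -> nat) N :
  (forall j, h j.+1 = #|[pred a : letter k face | ldeg a == j.+1]|) ->
  cauchy_prod (fun i => (size (@bas k r face i))%:Z) (golod_denom h) N =
    'C(r, N)%:Z.
Proof.
move=> hE; pose b i := size (@bas k r face i).
have -> : 'C(r, N)%:Z = (b N)%:Z -
    \sum_(a : letter k face | (ldeg a < N)%N) (b (N - (ldeg a).+1)%N)%:Z.
  by rewrite /b size_bas PoszD (raddf_sum (GRing.RMorphism.clone _ _ Posz _)) addrK.
rewrite /cauchy_prod big_ord_recr /= subnn /= mulr1 addrC; congr (_ + _).
rewrite -sumrN (reindex_inj rev_ord_inj) /=.
transitivity (\sum_(j < N) \sum_(a : letter k face | ldeg a == j)
    - (b (N - j.+1)%N)%:Z); last first.
  rewrite (exchange_big_dep (fun a : letter k face => ldeg a < N)%N) /=.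
    by apply: eq_bigr => a aN; rewrite (big_pred1 (Ordinal aN)).
  by move=> j a _ /eqP->.
apply: eq_bigr => j _; rewrite sumr_const subKn //.
(* There is no letter of degree 0, which matches the zero coefficient of t in [golod_denom]. *)
case: (nat_of_ord j) => [|i] /=.
  by rewrite mulr0 eq_card0 // => a; rewrite !inE /ldeg.
by rewrite hE mulrN -[X in _ * X]natz mulr_natr mulNrn.
Qed.

(** * Betti numbers and generators *)

Import GRing.Theory.


Section Invariants.
Variables (k : fieldType) (R : comNzRingType) (r : nat).
Variables (iota : k -> R) (y : 'I_r -> R) (P : stanley_reisner iota y).
Local Notation face := (face P).
Local Notation cf := (cf P).
Local Notation letter := (letter k face).
Local Notation K := (koszul R r).
Local Notation d := (koszul_diff y).
Implicit Types (S T U : {set 'I_r}) (a b : letter) (x z : R) (i s t : 'I_r).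

Lemma kbas_deg S : koszul_deg #|S| (kbas R S).
Proof. by move=> T; rewrite ffunE; case: (T =P S) => // ->; rewrite eqxx. Qed.

Lemma koszul_betti0 :
  quot_dim iota (V := K) (koszul_cycle y 0) (koszul_bound y 0) 1.
Proof.
exists (fun=> kbas R set0); split=> [_|c|u [udeg _]].
- split; first by rewrite -(cards0 'I_r); apply: kbas_deg.
  apply/ffunP=> T; rewrite [RHS]ffunE; apply/eqP; apply/negPn/negP.
  by case/kbas_neq0 => s; rewrite inE.
- rewrite big_ord1 => -[g [_ E]] i; rewrite ord1.
  move/ffunP/(_ set0): E; rewrite 2!ffunE eqxx kdE => /(congr1 (cf^~ 0%MM)).
  rewrite cf_const cf1 eqxx mulr1 => ->; rewrite (cf_sum P) big1 // => s _.
  by rewrite -mulrA (cf_sign P) cf_var mnm0E mulr0.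
pose c := cf (u set0) 0%MM.
have [h hE] : exists h, u set0 - iota c = \sum_i h i * y i.
  by apply: (cf_aug (s0 := P)); rewrite (cfB P) (cf_iota P) eqxx mulr1 subrr.
exists (fun=> c); rewrite big_ord1; exists (\sum_i h i *: kbas R [set i]); split.
  move=> T Tj; rewrite sum_ffunE big1 // => i _; rewrite ffunE kbas_deg ?scaler0 //.
  by rewrite cards1.
apply/ffunP=> T; rewrite kd_sum sum_ffunE.
under eq_bigr do rewrite kdZ ffunE d_kbas1 /GRing.scale /= mulrCA.
rewrite -mulr_sumr -hE.
have -> : (u - iota c *: kbas R set0) T = u T - iota c * (T == set0)%:R.
  by rewrite !ffunE.
have [->|T0] := eqVneq T set0; first by rewrite mulr1 mul1r.
by rewrite udeg ?cards_eq0 // mulr0 oppr0 addr0 mul0r.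
Qed.

Definition golod_betti (j : nat) : nat :=
  if j is 0 then 1%N else #|[pred a : letter | ldeg a == j]|.

Lemma koszul_betti j :
  quot_dim iota (V := K) (koszul_cycle y j) (koszul_bound y j) (golod_betti j).
Proof.
case: j => [|j]; first exact: koszul_betti0.
pose A := [pred a : letter | ldeg a == j.+1].
have sumA (F : letter -> K) : \sum_(l < #|A|) F (enum_val l) =
    \sum_(a | ldeg a == j.+1) F a by rewrite -big_enum_val.
exists (fun l : 'I_#|A| => lcyc (enum_val l : letter)); split=> [l|c H l|u ucyc].
- have /eqP e := enum_valP l; split; last exact: lcyc_cycle.
  by rewrite -e; apply: lcyc_deg.
- pose e a := if [pick l : 'I_#|A| | enum_val l == a] is Some l then c l else 0.
  have eE l' : e (enum_val l') = c l'.
    rewrite /e; case: pickP => [l0 /eqP/enum_val_inj-> //|/(_ l')].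
    by rewrite eqxx.
  rewrite -eE; apply: (@lcyc_indep _ _ _ _ _ P j.+1); last exact/eqP/(enum_valP l).
  rewrite -sumA; under eq_bigr do rewrite eE; exact: H.
have [e H] := @lcyc_span _ _ _ _ _ P j.+1 u (ltn0Sn _) ucyc.
by exists (fun l => e (enum_val l)); rewrite (sumA (fun a => iota (e a) *: lcyc a)).
Qed.

Variables (M : R -> Prop).
Hypothesis ME : forall x, M x <-> cf x 0%MM = 0.

(** A product of two elements without constant term has only monomials of degree at least 2. *)
Lemma cf_ideal_prod x s : ideal_prod M M x -> cf x U_(s)%MM = 0.
Proof.
case=> l [lP ->]; rewrite (cf_sum P) big1_seq // => q /andP[_ /lP].
case=> f [g [/ME f0 /ME g0 ->]]; apply/eqP/negPn/negP.
case/cf_mul=> m1 [m2 [e _ /cf_mul[m3 [m4 [e' c3 c4]]]]].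
have m30 : m3 != 0%MM by apply: contraNneq c3 => ->; rewrite f0.
have m40 : m4 != 0%MM by apply: contraNneq c4 => ->; rewrite g0.
move/(congr1 (@mdeg r)): e; rewrite e' !mdegD mdeg1.
by move: m30 m40; rewrite -!mdeg_eq0; lia.
Qed.

Lemma edim_sr : quot_dim iota (V := R^o) M (ideal_prod M M) r.
Proof.
exists y; split=> [i|c H i|u /ME/(cf_aug (s0 := P))[h ->]].
- by apply/ME; rewrite (cf_y P) eq_sym mnm1_eq0.
- have := cf_ideal_prod i H; rewrite (cf_sum P) (bigD1 i) //= big1.
    by rewrite addr0 cf_const (cf_y P) eqxx mulr1.
  by move=> t ti; rewrite cf_const (cf_y P) eq_mnm1 eq_sym (negbTE ti) mulr0.
exists (fun i => cf (h i) 0%MM).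
exists [seq (1, (h i - iota (cf (h i) 0%MM)) * y i) | i <- enum 'I_r]; split.
  move=> q /mapP[i _ ->] /=; exists (h i - iota (cf (h i) 0%MM)), (y i); split=> //.
    by apply/ME; rewrite (cfB P) (cf_iota P) eqxx mulr1 subrr.
  by apply/ME; rewrite (cf_y P) eq_sym mnm1_eq0.
rewrite big_map big_enum /= -sumrB; apply: eq_bigr => i _.
by rewrite mul1r mulrBl.
Qed.

Lemma gens_sr x : M x <-> ideal_gen (fun z => exists s, z = y s) x.
Proof.
split=> [/ME/(cf_aug (s0 := P))[h ->]|[l [lP ->]]].
  exists [seq (h i, y i) | i <- enum 'I_r]; split.
    by move=> q /mapP[i _ ->]; exists i.
  by rewrite big_map big_enum.
apply/ME; rewrite (cf_sum P) big1_seq // => q /andP[_ /lP[s ->]].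
by rewrite mulrC cf_var mnm0E.
Qed.

Lemma min_gens_sr t :
  ~ forall x, M x -> ideal_gen (fun z => exists2 s, s != t & z = y s) x.
Proof.
move=> /(_ (y t)) []; first by apply/ME; rewrite (cf_y P) eq_sym mnm1_eq0.
move=> l [lP /(congr1 (cf^~ U_(t)%MM))]; rewrite (cf_y P) eqxx (cf_sum P).
rewrite big1_seq => [/eqP|q /andP[_ /lP[s st ->]]]; first by rewrite oner_eq0.
by rewrite mulrC cf_var mnm1E eq_sym (negbTE st).
Qed.
End Invariants.

(** * Quotients by squarefree monomial ideals *)

Import GRing.Theory.



Section Quotient.
Local Open Scope quotient_scope.
Variables (k : fieldType) (n : nat) (I : idealr {mpoly k[n]}).
Local Notation Q := {mpoly k[n]}.
Local Notation R := {ideal_quot I}.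
Local Notation inI := (fun f : Q => (f \in I) : Prop).
Hypothesis sqfI : sqfree_monomial_ideal inI.
Implicit Types (f g : Q) (x z : R) (m : 'X_{1..n}) (A B : {set 'I_n}).

Definition qface : pred {set 'I_n} := fun A => 'X_[mesym1 A] \notin I.

Lemma mpolyX_ideal_le m m' :
  (m' <= m)%MM -> 'X_[m'] \in I -> ('X_[m] : Q) \in I.
Proof. by move=> le mI; rewrite -(submK le) mpolyXD idealMr. Qed.

Lemma mesym1_msup_le m : (mesym1 (msup m) <= m)%MM.
Proof. by apply/mnm_lepP => i; rewrite mesym1E inE; case: (m i). Qed.

Lemma nface_mem m : ~~ qface (msup m) -> ('X_[m] : Q) \in I.
Proof. by rewrite negbK; apply: mpolyX_ideal_le; apply: mesym1_msup_le. Qed.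

(** A squarefree generator dividing a monomial already divides the product of the variables in its
    support. Together with [nface_mem] this shows that I is spanned by the monomials supported on
    nonfaces. *)
Lemma face_coef f m : f \in I -> qface (msup m) -> f@_m = 0.
Proof.
have [S [Ssqf IE]] := sqfI; move=> /IE[l [lP ->]] nf.
rewrite raddf_sum /= big1_seq // => q /andP[_ /lP[m' Sm' ->]].
apply/eqP/negPn/negP; rewrite -mcoeff_msupp (perm_mem (msuppMX _ _)).
case/mapP=> m1 _ e; case/negP: nf.
have m'I : 'X_[m'] \in I.
  apply/IE; exists [:: (1, 'X_[m'])]; rewrite big_seq1 mul1r; split=> // p.
  by rewrite inE => /eqP->; exists m'.
apply: mpolyX_ideal_le m'I; apply/mnm_lepP=> i.
by have := Ssqf _ Sm' i; rewrite mesym1E inE e mnmDE; case: (m' i) => [|[|]].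
Qed.

Lemma qface0 : qface set0.
Proof. by rewrite /qface mesym1_set0 mpolyX0 idealr1. Qed.

Lemma qfaceS A B : A \subset B -> qface B -> qface A.
Proof.
move/subsetP=> AB; apply: contraNN; apply: mpolyX_ideal_le.
by apply/mnm_lepP=> i; rewrite !mesym1E; case: (boolP (i \in A)) => // /AB->.
Qed.

(* Only the variables outside the ideal contribute to the embedding dimension;
   [mlift] and [mrestr] translate between their exponents and the exponents in
   all variables. *)
Definition nvars : nat := #|[pred i | qface [set i]]|.
Definition vidx (s : 'I_nvars) : 'I_n := enum_val s.

Lemma vidx_inj : injective vidx.
Proof. exact: enum_val_inj. Qed.

Lemma vidx_face s : qface [set vidx s].
Proof. exact: (enum_valP s). Qed.

Lemma vidx_ex i : qface [set i] -> exists s, i = vidx s.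
Proof.
move=> fi; have fi' : i \in [pred j | qface [set j]] by [].
by exists (enum_rank_in fi' i); rewrite /vidx enum_rankK_in.
Qed.

Implicit Types (e : 'X_{1..nvars}) (s : 'I_nvars).

Definition mlift e : 'X_{1..n} :=
  [multinom (\sum_(s | vidx s == i) e s)%N | i < n].
Definition mrestr m : 'X_{1..nvars} := [multinom m (vidx s) | s < nvars].

Lemma mlift_vidx e s : mlift e (vidx s) = e s.
Proof. by rewrite mnmE (big_pred1 s) // => t /=; rewrite (inj_eq vidx_inj). Qed.

Lemma mliftK : cancel mlift mrestr.
Proof. by move=> e; apply/mnmP=> s; rewrite mnmE mlift_vidx. Qed.

Lemma mrestrD m m' : mrestr (m + m') = (mrestr m + mrestr m')%MM.
Proof. by apply/mnmP=> s; rewrite !(mnmE, mnmDE). Qed.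

Lemma mliftD e e' : mlift (e + e')%MM = (mlift e + mlift e')%MM.
Proof.
apply/mnmP=> i; rewrite mnmDE !mnmE -big_split; apply: eq_bigr => s _.
by rewrite mnmDE.
Qed.

Lemma mlift0 : mlift 0%MM = 0%MM.
Proof. by apply/mnmP=> i; rewrite mnmE mnm0E big1 // => s _; rewrite mnm0E. Qed.

Lemma mlift1 s : mlift U_(s)%MM = U_(vidx s)%MM.
Proof.
apply/mnmP=> i; rewrite mnmE mnm1E; have [<-|ni] := eqVneq (vidx s) i.
  by rewrite (big_pred1 s) ?mnm1E ?eqxx // => t /=; rewrite (inj_eq vidx_inj).
rewrite big1 // => t /eqP ti.
by rewrite mnm1E; case: (s =P t) ni => // ->; rewrite ti eqxx.
Qed.

Lemma mrestrK m : qface (msup m) -> mlift (mrestr m) = m.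
Proof.
move=> fm; apply/mnmP=> i; rewrite mnmE.
have [mi|mi] := posnP (m i).
  by rewrite mi big1 // => s /eqP si; rewrite mnmE si mi.
have [|s ->] := @vidx_ex i; first by apply: qfaceS fm; rewrite sub1set inE.
by rewrite (big_pred1 s) ?mnmE // => t /=; rewrite (inj_eq vidx_inj).
Qed.

Definition sface : pred {set 'I_nvars} := fun A : {set 'I_nvars} => qface (vidx @: A).

Lemma msup_mlift e : msup (mlift e) = vidx @: msup e.
Proof.
apply/setP=> i; rewrite inE; apply/idP/imsetP => [|[s]]; last first.
  by rewrite inE => es ->; rewrite mlift_vidx.
rewrite mnmE => pos.
have [s /andP[/eqP <- es]] : exists s, (vidx s == i) && (0 < e s)%N.
  apply/existsP; apply: contraTT pos => /existsPn H.
  rewrite -eqn0Ngt big1 // => s si.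
  by have := H s; rewrite si /= -eqn0Ngt => /eqP.
by exists s; rewrite ?inE.
Qed.

Lemma mlift_mesym1 (A : {set 'I_nvars}) : mlift (mesym1 A) = mesym1 (vidx @: A).
Proof.
apply/mnmP=> i; rewrite mesym1E.
have [/imsetP[s sA ->]|nA] := boolP (i \in vidx @: A).
  by rewrite mlift_vidx mesym1E sA.
rewrite mnmE big1 // => s /eqP si; rewrite mesym1E.
by case: (boolP (s \in A)) => // sA; case/negP: nA; rewrite -si imset_f.
Qed.

Lemma sfaceE e : sface (msup e) = qface (msup (mlift e)).
Proof. by rewrite msup_mlift. Qed.

(** Off the faces the coefficient would depend on the chosen representative; on the faces
    [face_coef] makes it well defined. *)
Definition qcf x e : k := if sface (msup e) then (repr x : Q)@_(mlift e) else 0.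

Lemma qcf_pi f e : qcf (\pi_R f) e = if sface (msup e) then f@_(mlift e) else 0.
Proof.
rewrite /qcf; case: ifP => // fe; apply/eqP; rewrite -subr_eq0 -mcoeffB.
rewrite face_coef -?sfaceE // Quotient.idealrBE; apply/eqP.
by rewrite reprK.
Qed.

Lemma pi_eq0 f : f \in I -> \pi_R f = 0.
Proof.
move=> fI; rewrite -[0](rmorph0 (\pi_R)); apply/eqP.
by rewrite -Quotient.idealrBE subr0.
Qed.

Definition qmon (A : {set 'I_nvars}) : R := \pi_R ('X_[mesym1 (vidx @: A)] : Q).

Definition mquo (i : 'I_n) f : Q :=
  \sum_(m <- msupp f | (1 < m i)%N) f@_m *: 'X_[m - U_(i)].

Lemma mcoeff_mquo i f m :
  (mquo i f)@_m = if (0 < m i)%N then f@_(m + U_(i)) else 0.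
Proof.
rewrite /mquo raddf_sum big_mkcond /= {3}[f]mpolyE raddf_sum /=.
case: ifP => mi; last first.
  rewrite big1 // => m' _; case: ifP => // mi'; rewrite mcoeffZ mcoeffX.
  case: eqP => [e|]; rewrite ?mulr0 //.
  by move: mi; rewrite -e mnmBE mnm1E eqxx subn_gt0 mi'.
apply: eq_bigr => m' _; rewrite !mcoeffZ !mcoeffX.
have [->|ne] := eqVneq m' (m + U_(i))%MM.
  by rewrite mnmDE mnm1E eqxx addn1 ltnS mi addmK eqxx.
rewrite mulr0; case: ifP => // mi'.
case: eqP => [e|]; rewrite ?mulr0 //; case/eqP: ne.
by rewrite -e submK // lep1mP; case: (m' i) mi'.
Qed.

Definition qquo (s : 'I_nvars) x : R := \pi_R (mquo (vidx s) (repr x)).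
Definition qvar (s : 'I_nvars) : R := \pi_R ('X_(vidx s) : Q).

Lemma qcf_var s x e : qcf (qvar s * x) e =
  if (0 < e s)%N && sface (msup e) then qcf x (e - U_(s))%MM else 0.
Proof.
rewrite -[x]reprK -rmorphM !qcf_pi andbC; case: ifP => //= fe; case: ifP => es.
  have -> : sface (msup (e - U_(s))%MM).
    apply: qfaceS fe; apply: imsetS; apply/subsetP=> t; rewrite !inE mnmBE.
    by case: (e t).
  have {1}-> : e = (U_(s) + (e - U_(s)))%MM.
    by rewrite addmC submK // lep1mP -lt0n.
  by rewrite mliftD mlift1 mulrC mcoeffMX.
apply/eqP/negPn/negP; rewrite -mcoeff_msupp mulrC (perm_mem (msuppMX _ _)).
case/mapP=> m _ /mnmP/(_ (vidx s)); rewrite mlift_vidx mnmDE mnm1E eqxx.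
by move/eqP; case: (e s) es.
Qed.

Lemma qaug x : qcf x 0%MM = 0 -> exists h, x = \sum_i h i * qvar i.
Proof.
rewrite -[x]reprK qcf_pi mlift0 sfaceE mlift0.
rewrite msup0 qface0; set p := repr x => p0.
rewrite [p]mpolyE rmorph_sum /=.
pose D (z : R) := exists h, z = \sum_i h i * qvar i.
rewrite -/(D _) big_seq; apply: (big_ind D) => [|z z' [f ->] [g ->]|m mp].
- by exists (fun=> 0); rewrite big1 // => i _; rewrite mul0r.
- exists (fun i => f i + g i); rewrite -big_split.
  by apply: eq_bigr => i _; rewrite mulrDl.
have m0 : m != 0%MM by apply: contraTneq mp => ->; rewrite mcoeff_msupp p0 eqxx.
have [i mi] : exists i, m i != 0%N.
  apply/existsP; apply: contraNT m0 => /existsPn H; apply/eqP/mnmP=> i.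
  by rewrite mnm0E; apply/eqP/negPn/H.
have -> : p@_m *: 'X_[m] = (p@_m *: 'X_[m - U_(i)]) * 'X_i.
  by rewrite -scalerAl -mpolyXD submK // lep1mP.
rewrite rmorphM; have [fi|fi] := boolP (qface [set i]).
  have [s ->] := vidx_ex fi.
  exists (fun t => if t == s then \pi_R (p@_m *: 'X_[m - U_(vidx s)] : Q) else 0).
  rewrite (bigD1 s) //= eqxx big1 ?addr0 // => t ts.
  by rewrite (negbTE ts) mul0r.
exists (fun=> 0); rewrite big1 => [|t _]; last by rewrite mul0r.
by rewrite [X in _ * X]pi_eq0 ?mulr0 //; move: fi; rewrite negbK mesym1_set1.
Qed.

Lemma qcf_mul x z e : qcf (x * z) e != 0 ->
  exists e1 e2, [/\ e = (e1 + e2)%MM, qcf x e1 != 0 & qcf z e2 != 0].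
Proof.
rewrite -[x]reprK -[z]reprK -rmorphM qcf_pi; case: ifP; last by rewrite eqxx.
move=> fe; rewrite -mcoeff_msupp => /msuppM_le/allpairsP[[m1 m2] /= [m1x m2z em]].
have f1 : qface (msup m1).
  rewrite sfaceE em in fe; apply: qfaceS fe; apply/subsetP=> i.
  by rewrite !inE mnmDE; lia.
have f2 : qface (msup m2).
  rewrite sfaceE em in fe; apply: qfaceS fe; apply/subsetP=> i.
  by rewrite !inE mnmDE; lia.
exists (mrestr m1), (mrestr m2); split.
- by rewrite -mrestrD -em mliftK.
- by rewrite qcf_pi sfaceE mrestrK // f1 -mcoeff_msupp.
- by rewrite qcf_pi sfaceE mrestrK // f2 -mcoeff_msupp.
Qed.

Lemma qcf_inj x : (forall e, qcf x e = 0) -> x = 0.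
Proof.
move=> H; rewrite -[x]reprK; apply: pi_eq0; rewrite [repr x]mpolyE.
apply: rpred_sum => m _; rewrite -mul_mpolyC.
have [fm|] := boolP (qface (msup m)); last by move/nface_mem; apply: idealMr.
have := H (mrestr m); rewrite /qcf sfaceE mrestrK // fm => ->.
by rewrite mpolyC0 mul0r rpred0.
Qed.

(** Closed by [Defined] so that [face] and [cf] of this structure unfold to [sface] and [qcf]
    afterwards. *)
Lemma quotient_stanley_reisner : stanley_reisner (@quot_const k n I) qvar.
Proof.
apply: (@StanleyReisner _ _ _ _ _ sface qcf qmon qquo).
- by rewrite /sface imset0 qface0.
- by move=> s; rewrite /sface imset_set1 vidx_face.
- by move=> A B AB; apply: qfaceS; apply: imsetS.
- move=> x z e; rewrite -[x]reprK -[z]reprK -rmorphD !qcf_pi.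
  by case: ifP; rewrite ?mcoeffD ?addr0.
- move=> e; rewrite -[1](rmorph1 (\pi_R)) qcf_pi mcoeff1.
  have -> : (mlift e == 0%MM) = (e == 0%MM).
    by rewrite -mlift0 (inj_eq (can_inj mliftK)).
  case: eqP => [->|_]; last by rewrite if_same.
  by rewrite sfaceE mlift0 msup0 qface0.
- move=> c x e; rewrite /quot_const -[x]reprK -rmorphM !qcf_pi mcoeffCM.
  by case: ifP; rewrite ?mulr0.
- exact: qcf_var.
- exact: qcf_inj.
- move=> A e; rewrite qcf_pi mcoeffX -mlift_mesym1.
  rewrite (inj_eq (can_inj mliftK)) eq_sym andbC.
  case: eqP => [->|_]; last by rewrite andbF if_same.
  by rewrite msup_mesym1 andbT; case: ifP.
- move=> s x e; rewrite qcf_pi mcoeff_mquo mlift_vidx.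
  rewrite -mlift1 -mliftD /qcf; case: (ltnP 0 (e s)) => es; last by rewrite if_same.
  rewrite (_ : msup (e + U_(s))%MM = msup e) //; apply/setP=> t.
  by rewrite !inE mnmDE mnm1E; case: eqP => [<-|]; rewrite ?addn0 // es addn1.
- exact: qcf_mul.
- by move=> x e; rewrite /qcf; case: ifP; rewrite ?eqxx.
- exact: qaug.
Defined.
End Quotient.

Import GRing.Theory.



(** * From the derivative hypothesis to the Golod property *)

Section GolodQuotient.
Local Open Scope quotient_scope.
Variables (k : fieldType) (n : nat) (I : idealr {mpoly k[n]}).
Local Notation Q := {mpoly k[n]}.
Local Notation R := {ideal_quot I}.
Local Notation inI := (fun f : Q => (f \in I) : Prop).
Hypothesis sqfI : sqfree_monomial_ideal inI.
Hypothesis dsqf : forall i j : 'I_n, i != j -> deriv_sqf_sub inI i j.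
Local Notation P := (quotient_stanley_reisner sqfI).

Lemma ideal_gen_mem (A : comNzRingType) (S : A -> Prop) (f : A) :
  S f -> ideal_gen S f.
Proof.
move=> Sf; exists [:: (1, f)]; rewrite big_seq1 mul1r; split=> // p.
by rewrite inE => /eqP->.
Qed.

(** Since i is not in A, the derivative of the monomial of i |: A with respect to x_i is that of A
    with coefficient 1, whatever the characteristic. *)
Lemma qface_golod : golod_complex (qface I).
Proof.
move=> i j A B ij dAB iA jB /negPn fA /negPn fB; apply/negPn; apply: (dsqf ij).
have dX (s : 'I_n) (C : {set 'I_n}) : s \notin C -> 'X_[mesym1 (s |: C)] \in I ->
    deriv_ideal s inI 'X_[mesym1 C].
  move=> sC sI; apply: ideal_gen_mem; exists 'X_[mesym1 (s |: C)] => //.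
  rewrite mderivX mesym1E setU11 scale1r mesym1U1 //.
  by rewrite addmC addmK.
have sq : sqfree_mnm (mesym1 (A :|: B)).
  by move=> s; rewrite mesym1E; case: (_ \in _).
apply: ideal_gen_mem; exists (mesym1 (A :|: B)); split=> //.
apply: ideal_gen_mem; exists 'X_[mesym1 A], 'X_[mesym1 B]; split; try exact: dX.
rewrite -mpolyXD; congr 'X_[_]; apply/mnmP=> s; rewrite mnmDE !mesym1E !inE.
have [sA|sA] := boolP (s \in A); last by rewrite add0n.
by rewrite (disjointFr dAB sA).
Qed.

Lemma sface_golod : golod_complex (face P).
Proof.
move=> i j A B ij dAB iA jB; rewrite /= /sface !imsetU !imset_set1.
have vI := @vidx_inj k n I.
move=> nA nB; apply: (@qface_golod (vidx i) (vidx j)) => //.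
- by rewrite (inj_eq vI).
- by rewrite imset_disjoint.
- by rewrite mem_imset.
- by rewrite mem_imset.
Qed.

Lemma residueE (x : R) : residue x = cf P x 0%MM.
Proof.
by rewrite /= /qcf sfaceE mlift0 msup0 qface0.
Qed.

Lemma max_idealE (x : R) : max_ideal x <-> cf P x 0%MM = 0.
Proof.
split=> [[l [lP ->]]|/(cf_aug (s0 := P))[h ->]].
  rewrite (cf_sum P) big1_seq // => q /andP[_ /lP[i ->]].
  rewrite mulrC; apply/eqP/negPn/negP => /cf_mul[m1 [m2 [/esym/eqP]]].
  rewrite mnmD_eq0 => /andP[/eqP-> _]; rewrite /= qcf_pi // mlift0 mcoeffX.
  by rewrite mnm1_eq0 if_same eqxx.
exists [seq (h i, @qvar k n I i) | i <- enum 'I_(nvars I)]; split.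
  by move=> q /mapP[i _ ->]; exists (vidx i).
by rewrite big_map big_enum.
Qed.

Lemma golod_quotient : golod I.
Proof.
exists (nvars I), (nvars I), (@qvar k n I), (golod_betti P).
exists (golod_resolution sface_golod residueE); split.
- exact: edim_sr max_idealE.
- split; last exact: min_gens_sr max_idealE.
    move=> s; exists 1%N; exists ('X_(vidx s) : Q) => //.
    by rewrite dhomogX; apply/eqP; apply: mdeg1.
  exact: gens_sr max_idealE.
- by move=> j; apply: koszul_betti; apply: sface_golod.
- move=> N; rewrite -(@golod_series k (nvars I) (face P) (golod_betti P)) //.
  by rewrite /cauchy_prod; apply: eq_bigr => i _; rewrite tor_dim_golod.
Qed.
End GolodQuotient.

Theorem theorem4p3 (k : fieldType) (n : nat) (I : idealr {mpoly k[n]}) :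
  let Iset := fun f : {mpoly k[n]} => (f \in I) : Prop in
  sqfree_monomial_ideal Iset ->
  ((forall i j : 'I_n, i != j -> deriv_sqf_sub Iset i j) -> golod I) /\
  (sqfree_strongly_golod Iset ->
     forall i j : 'I_n, i != j -> deriv_sqf_sub Iset i j).
Proof.
by move=> Iset sqfI; split=> [|[_ H] i j _]; [apply: golod_quotient | apply: H].
Qed.
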